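(* The problem $\textsc{Comp-Sub}(\mathcal{PM})$ is $\mathsf{GI}$-hard when restricted to input graphs $G$ that contain, for no $k \geq 7$, the cycle $C_k$ or its complement $\overline{C_k}$ as an induced subgraph.
   Context: All graphs are finite, simple and undirected. $\textsc{Comp-Sub}(\mathcal{PM})$ is the decision problem: given a graph $G=(V,E)$, can $V$ be partitioned into $V_1,V_2$ such that $G[V_1]$ is isomorphic to the complement of $G[V_2]$ (i.e. $G$ decomposes into some graph $H$ and its complement $\overline{H}$) and the set of edges of $G$ between $V_1$ and $V_2$ is a perfect matching (every vertex is incident to exactly one such edge)? $\textsc{Graph Isomorphism}$ asks, given two graphs, whether they are isomorphic. $\mathsf{GI}$ is the class of problems admitting a polynomial-time reduction to $\textsc{Graph Isomorphism}$; a problem is $\mathsf{GI}$-hard if every problem in $\mathsf{GI}$ is polynomial-time reducible to it. $C_k$ denotes the cycle on $k$ vertices. *)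

(* Defs.v *)
From mathcomp Require Import all_boot all_order all_algebra.

Set Implicit Arguments.
Unset Strict Implicit.
Unset Printing Implicit Defensive.

Record sgraph := SGraph {
  vertex :> finType;
  edge : rel vertex;
  edge_sym : symmetric edge;
  edge_irr : irreflexive edge
}.

Definition isomorphic (G H : sgraph) : Prop :=
  exists f : G -> H, bijective f /\ forall x y, edge (f x) (f y) = edge x y.

Section Constructions.
Variable G : sgraph.

Definition compl_edge : rel G := fun x y => (x != y) && ~~ edge x y.

Fact compl_edge_sym : symmetric compl_edge.
Proof. by move=> x y; rewrite /compl_edge eq_sym edge_sym. Qed.

Fact compl_edge_irr : irreflexive compl_edge.
Proof. by move=> x; rewrite /compl_edge eqxx. Qed.

Definition compl : sgraph := SGraph compl_edge_sym compl_edge_irr.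

Variable A : {set G}.

Definition induced_edge : rel {x : G | x \in A} :=
  fun x y => edge (val x) (val y).

Fact induced_edge_sym : symmetric induced_edge.
Proof. by move=> x y; rewrite /induced_edge edge_sym. Qed.

Fact induced_edge_irr : irreflexive induced_edge.
Proof. by move=> x; rewrite /induced_edge edge_irr. Qed.

Definition induced : sgraph := SGraph induced_edge_sym induced_edge_irr.

End Constructions.

Section CycleGraph.
Variable k : nat.

(* This is the cycle C_k for k >= 3. *)
Definition cycle_edge : rel 'I_k :=
  fun i j => (i != j) && ((i.+1 %% k == j) || (j.+1 %% k == i)).

Fact cycle_edge_sym : symmetric cycle_edge.
Proof. by move=> i j; rewrite /cycle_edge eq_sym orbC. Qed.

Fact cycle_edge_irr : irreflexive cycle_edge.
Proof. by move=> i; rewrite /cycle_edge eqxx. Qed.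

Definition cycle_graph : sgraph := SGraph cycle_edge_sym cycle_edge_irr.

End CycleGraph.

Definition has_induced (G H : sgraph) : Prop :=
  exists A : {set G}, isomorphic (induced A) H.

Definition no_long_cycle_or_compl (G : sgraph) : Prop :=
  forall k, 7 <= k ->
    ~ has_induced G (cycle_graph k) /\ ~ has_induced G (compl (cycle_graph k)).

Definition cut_perfect_matching (G : sgraph) (A : {set G}) : Prop :=
  forall x : G, exists! y : G, edge x y /\ (x \in A) != (y \in A).

Definition comp_sub_pm (G : sgraph) : Prop :=
  exists A : {set G},
    isomorphic (induced A) (compl (induced (~: A))) /\ cut_perfect_matching A.

(* Tape alphabet {0, 1, blank}; the blank is None. *)
Definition symbol := option bool.

(* Two-way infinite tape; cells are numbered relative to the head, which is
   at cell 0. *)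
Definition tape := int -> symbol.

Inductive move := MoveL | MoveN | MoveR.

Definition offset (m : move) : int :=
  match m with MoveL => -1 | MoveN => 0 | MoveR => 1 end%R.

Definition write_move (a : symbol * move) (t : tape) : tape :=
  fun i => let j := (i + offset a.2)%R in if j == 0%R then a.1 else t j.

Definition blank_tape : tape := fun=> None.

Definition word_tape (w : seq bool) : tape :=
  fun i => if i is Posz n then onth w n else None.

(* The word read from the head rightwards up to the first blank is w. *)
Definition tape_reads (t : tape) (w : seq bool) : Prop :=
  forall n : nat, n <= size w -> t (Posz n) = onth w n.

Record machine := Machine {
  state : finType;
  track : finType;  (* the index set of the tapes *)
  in_track : track;
  out_track : track;
  start : state;
  halting : pred state;
  trans : state -> {ffun track -> symbol} ->
          state * {ffun track -> symbol * move}
}.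

Record config (M : machine) := Config {
  cstate : state M;
  ctape : track M -> tape
}.

Definition init (M : machine) (w : seq bool) : config M :=
  Config (start M)
    (fun i => if i == in_track M then word_tape w else blank_tape).

Definition step (M : machine) (c : config M) : config M :=
  if halting (cstate c) then c else
  let qa := trans (cstate c) [ffun i => ctape c i 0%R] in
  Config qa.1 (fun i => write_move (qa.2 i) (ctape c i)).

(* As step fixes halting configurations, this says that M halts after at most
   t steps. *)
Definition outputs_within (M : machine) (w v : seq bool) (t : nat) : Prop :=
  let c := iter t (@step M) (init M w) in
  halting (cstate c) /\ tape_reads (ctape c (out_track M)) v.

(* The question yes is only asked of the objects satisfying instance. *)
Record problem := Problem {
  object : Type;
  enc : object -> seq bool;
  enc_inj : injective enc;
  instance : object -> Prop;
  yes : object -> Prop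
}.

Definition restrict (P : problem) (C : object P -> Prop) : problem :=
  Problem (@enc_inj P) (fun a => instance a /\ C a) (@yes P).

Arguments restrict : clear implicits.

Definition polytime (P Q : problem) (f : object P -> object Q) : Prop :=
  exists (M : machine) (p : {poly nat}), forall a : object P, instance a ->
    outputs_within M (enc a) (enc (f a)) (p.[size (enc a)])%R.

Definition reduces (P Q : problem) : Prop :=
  exists f : object P -> object Q,
    polytime f /\
    forall a, instance a -> instance (f a) /\ (yes a <-> yes (f a)).

Record mgraph := MGraph {
  nvert : nat;
  adjmx : 'M[bool]_nvert;
  adjmxP : [forall i, ~~ adjmx i i] && (adjmx^T == adjmx)%R
}.

Section MGraph.
Variable G : mgraph.

Definition mgraph_edge : rel 'I_(nvert G) := fun i j => adjmx G i j.

Fact mgraph_edge_sym : symmetric mgraph_edge.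
Proof.
move=> i j; rewrite /mgraph_edge; case/andP: (adjmxP G) => _ /eqP E.
by rewrite -[in LHS]E mxE.
Qed.

Fact mgraph_edge_irr : irreflexive mgraph_edge.
Proof. by move=> i; case/andP: (adjmxP G) => /forallP/(_ i)/negbTE. Qed.

Definition sgraph_of : sgraph := SGraph mgraph_edge_sym mgraph_edge_irr.

(* The number of vertices in unary, then the adjacency matrix by rows. *)
Definition enc_mgraph : seq bool :=
  nseq (nvert G) true ++ false ::
  [seq adjmx G i j | i <- enum 'I_(nvert G), j <- enum 'I_(nvert G)].

End MGraph.

Coercion sgraph_of : mgraph >-> sgraph.

Lemma enc_mgraph_cat_inj (G H : mgraph) (s t : seq bool) :
  enc_mgraph G ++ s = enc_mgraph H ++ t -> G = H /\ s = t.
Proof.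
case: G H => [n A AP] [m B BP]; rewrite /enc_mgraph /= -!catA /= => E.
have Enm : n = m.
  have find_false k r : find negb (nseq k true ++ false :: r) = k.
    by elim: k => //= k ->.
  by have := congr1 (find negb) E; rewrite !find_false.
case: m / Enm B BP E => B BP /eqP; rewrite eqseq_cat // eqxx /= eqseq_cons /=.
rewrite eqseq_cat ?size_allpairs // => /andP[/eqP/eq_in_allpairs EAB /eqP->].
split=> //; have {}EAB : A = B.
  by apply/matrixP=> i j; apply: EAB; rewrite mem_enum.
by case: B / EAB BP => BP; congr MGraph; apply: eq_irrelevance.
Qed.

Lemma enc_mgraph_inj : injective enc_mgraph.
Proof.
move=> G H E; apply: (proj1 (@enc_mgraph_cat_inj G H [::] [::] _)).
by rewrite !cats0.
Qed.

Definition enc_mgraph2 (GH : mgraph * mgraph) : seq bool :=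
  enc_mgraph GH.1 ++ enc_mgraph GH.2.

Lemma enc_mgraph2_inj : injective enc_mgraph2.
Proof.
by move=> [G H] [G' H'] /enc_mgraph_cat_inj[/= -> /enc_mgraph_inj ->].
Qed.

Definition GraphIsomorphism : problem :=
  Problem enc_mgraph2_inj (fun=> True)
    (fun GH : mgraph * mgraph => isomorphic GH.1 GH.2).

Definition CompSubPM : problem :=
  Problem enc_mgraph_inj (fun=> True) (fun G : mgraph => comp_sub_pm G).

Definition in_GI (P : problem) : Prop := reduces P GraphIsomorphism.

Definition GI_hard (Q : problem) : Prop :=
  forall P : problem, in_GI P -> reduces P Q.

(* Main.v *)
Require Import Defs.
From HB Require Import structures.
From Stdlib Require Import FunctionalExtensionality.
From mathcomp Require Import all_boot all_order all_algebra.
From mathcomp Require Import zify.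

Set Implicit Arguments.
Unset Strict Implicit.
Unset Printing Implicit Defensive.

(** Let G1 and G2 be graphs with the same vertex set V, n = |V|.  The split graph
    S(G) consists of a clique and an independent set, each made of three copies
    (tags 0, 1, 2) of V.  Tags (0,0), (0,1) and (1,0) are joined by the identity
    of V, tags (1,1) by the adjacency of G, tags (1,2) and (2,1) completely, and
    the others not at all; for n >= 2, G can be recovered from S(G).  The graph
    produced from (G1, G2) is the disjoint union of S(G1) and the complement of
    S(G2), together with the identity matching.  Its vertices split into two
    cliques without edges between them and one independent set, which excludes
    long induced cycles and their complements.  In any decomposition, a clique
    with three vertices lies on one side of the cut, since every vertex has a
    single cross edge; the two cliques lie on different sides because the rest
    is independent; and every other vertex has two neighbours in its own
    clique, hence follows it.  So S(G1) and S(G2) are isomorphic.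

    For the running time, machines are assembled from fragments composed by
    sequencing, branching and looping.  The reduction appends to the given
    machine a fragment which reads its output tape; with the two adjacency
    matrices and the identity matrix on three tapes, read in parallel, every
    bit of the new adjacency matrix is a function of the three scanned bits. *)

(** * Induced cycles *)

Lemma has_induced_inj (G H : sgraph) : has_induced G H ->
  exists g : H -> G, injective g /\ forall x y, edge (g x) (g y) = edge x y.
Proof.
case=> A [f [[g fK gK] fE]]; exists (val \o g); split.
  by move=> x y /val_inj /(can_inj gK).
by move=> x y; rewrite -[edge x y]/(edge x y) -{2}(gK x) -{2}(gK y) fE.
Qed.

(** A boolean quantifier: nested for each vertex, it turns statements about all colourings of seven
    or eight vertices into closed terms that [vm_compute] decides. *)
Definition all_colours (P : option bool -> bool) : bool :=
  [&& P None, P (Some true) & P (Some false)].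

Lemma all_coloursP (P : option bool -> bool) : all_colours P -> forall c, P c.
Proof. by case/and3P => ? ? ? [[]|]. Qed.

Definition all_pairs_lt (n : nat) (P : nat -> nat -> bool) : bool :=
  all (fun j => all (P^~ j) (iota 0 j)) (iota 0 n).

Lemma all_pairs_ltP n (P : nat -> nat -> bool) :
  (forall i j, i < j < n -> P i j) -> all_pairs_lt n P.
Proof.
move=> H; apply/allP => j; rewrite mem_iota => /andP[_ jn].
by apply/allP => i; rewrite mem_iota => /andP[_ ij]; apply: H; lia.
Qed.

Definition mono (c d : option bool) : bool := (c == d) && (c != None).

(* The vertices 0, ..., 7 of a cycle of length k >= 7, where 7 denotes 0 if
   k = 7: two disjoint edges cannot cover the seven edges {i, i + 1}. *)
Definition cycle_colouring (k7 : bool) (s : seq (option bool)) : bool :=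
  let c i := nth None s i in
  all (fun i => (c i != None) || (c i.+1 != None)) (iota 0 7) &&
  all_pairs_lt (if k7 then 7 else 8) (fun i j =>
    (i.+1 < j) && ~~ ((i == 0) && (6 + ~~ k7 == j)) ==> ~~ mono (c i) (c j)).

Lemma cycle_colouringN (k7 : bool) c0 c1 c2 c3 c4 c5 c6 c7 : (k7 -> c7 = c0) ->
  ~~ cycle_colouring k7 [:: c0; c1; c2; c3; c4; c5; c6; c7].
Proof.
move=> E; have {E} : k7 ==> (c7 == c0) by apply/implyP => /E ->.
apply/implyP; move: c7; apply: all_coloursP; move: c6; apply: all_coloursP.
move: c5; apply: all_coloursP; move: c4; apply: all_coloursP.
move: c3; apply: all_coloursP; move: c2; apply: all_coloursP.
move: c1; apply: all_coloursP; move: c0; apply: all_coloursP.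
by case: k7; vm_compute.
Qed.

(** The constraints on seven successive vertices of the complement of a cycle. Consecutive ones are
    non-adjacent, so share no clique; any other two are adjacent, so either share a clique or
    exactly one of them is uncoloured. [k7] makes 0 and 6 consecutive. *)
Definition co_cycle_colouring (k7 : bool) (s : seq (option bool)) : bool :=
  let c i := nth None s i in
  all_pairs_lt 7 (fun i j =>
    if (i.+1 == j) || [&& i == 0, j == 6 & k7] then ~~ mono (c i) (c j)
    else (c i == c j) == (c i != None) && (c j != None)).

(** Uncoloured vertices are pairwise consecutive, so there are at most two. Among the others, some
    vertex is consecutive to neither of two consecutive ones; these would both have its colour, yet
    their colours differ. *)
Lemma co_cycle_colouringN k7 c0 c1 c2 c3 c4 c5 c6 :
  ~~ co_cycle_colouring k7 [:: c0; c1; c2; c3; c4; c5; c6].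
Proof.
move: c6; apply: all_coloursP; move: c5; apply: all_coloursP.
move: c4; apply: all_coloursP; move: c3; apply: all_coloursP.
move: c2; apply: all_coloursP; move: c1; apply: all_coloursP.
by move: c0; apply: all_coloursP; case: k7; vm_compute.
Qed.

Lemma no_long_cycle_or_compl_of_colouring (G : sgraph) (c : G -> option bool) :
  (forall x y, c x = None -> c y = None -> ~~ edge x y) ->
  (forall x y b, c x = Some b -> c y = Some b -> x != y -> edge x y) ->
  (forall x y b, c x = Some b -> c y = Some (~~ b) -> ~~ edge x y) ->
  no_long_cycle_or_compl G.
Proof.
move=> cN cK cD k k7.
have ltk i : i %% k < k by rewrite ltn_mod; lia.
pose v i : 'I_k := Ordinal (ltk i).
have vE i : i < k -> v i = i :> nat by move=> ?; rewrite /= modn_small.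
have vk : v k = 0 :> nat by rewrite /= modnn.
have modS i : i < k -> (i.+1 %% k) = if i.+1 == k then 0 else i.+1.
  by case: eqP => [->|ne] lt; [rewrite modnn|rewrite modn_small //; lia].
have vneq i j : i < k -> j < k -> (v i == v j) = (i == j).
  by move=> ? ?; rewrite -val_eqE /= !modn_small.
have adjE i j : i < k -> j < k -> cycle_edge (v i) (v j) =
   [|| i.+1 == j, j.+1 == i, (i.+1 == k) && (j == 0) | (j.+1 == k) && (i == 0)].
  move=> ltik ltjk; rewrite /cycle_edge vneq // !vE // !modS //.
  by case: (i.+1 =P k) => ?; case: (j.+1 =P k) => ?; lia.
split=> /has_induced_inj[g [g_inj gE]].
- have P i : i < 7 -> c (g (v i)) = None -> c (g (v i.+1)) = None -> False.
    move=> lti ci cj; have := cN _ _ ci cj; rewrite gE /= => /negP; apply.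
    (* Indices are taken modulo [k], so only [i] = 6 with [k] = 7 wraps around. *)
    have [ik|ik] := ltnP i.+1 k; first by rewrite adjE // ?eqxx //; lia.
    have -> : v i.+1 = v 0.
      by apply: val_inj => /=; rewrite mod0n (_ : i.+1 = k) ?modnn //; lia.
    by rewrite adjE; lia.
  have Q i j b : i < k -> j < k -> i.+1 < j ->
     c (g (v i)) = Some b -> c (g (v j)) = Some b -> (i == 0) && (j.+1 == k).
    move=> ltik ltjk lij ci cj; have := cK _ _ _ ci cj.
    by rewrite (inj_eq g_inj) gE vneq //= adjE //; lia.
  pose col i := c (g (v i)).
  have := @cycle_colouringN (k == 7) (col 0) (col 1) (col 2) (col 3) (col 4)
    (col 5) (col 6) (col 7) _.
  have sE : [:: col 0; col 1; col 2; col 3; col 4; col 5; col 6; col 7]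
            = [seq col i | i <- iota 0 8] by [].
  rewrite sE => /(_ _)/negP; apply.
    by move=> /eqP k_eq; rewrite /col; congr (c (g _)); apply: val_inj; rewrite /= k_eq.
  have nthE i : i < 8 -> nth None [seq col i | i <- iota 0 8] i = col i.
    by move=> lti; rewrite (nth_map 0) ?size_iota // nth_iota.
  apply/andP; split.
    apply/allP => i; rewrite mem_iota => lti; rewrite !nthE; try lia.
    have := @P i; rewrite -/(col i) -/(col i.+1).
    by case: (col i) => //; case: (col i.+1) => // /(_ _ erefl erefl) [] //; lia.
  apply: all_pairs_ltP => i j ltij; apply/implyP=> lij.
  have {}ltij : i < j < 8 /\ j < k by case: eqP ltij => ?; lia.
  rewrite !nthE; try lia.
  apply/negP => /andP[/eqP cij].
  case ci: (col i) cij => [b|] // /esym cj _.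
  have := @Q i j b _ _ _ ci cj.
  by case: eqP lij => ? ? H; have := H _ _ _; lia.
- pose col i := c (g (v i)).
  have := @co_cycle_colouringN (k == 7) (col 0) (col 1) (col 2) (col 3) (col 4)
    (col 5) (col 6).
  have sE : [:: col 0; col 1; col 2; col 3; col 4; col 5; col 6]
            = [seq col i | i <- iota 0 7] by [].
  have nthE i : i < 7 -> nth None [seq col i | i <- iota 0 7] i = col i.
    by move=> lti; rewrite (nth_map 0) ?size_iota // nth_iota.
  rewrite sE => /negP; apply; apply: all_pairs_ltP => i j ltij.
  rewrite !nthE; try lia.
  have E : edge (g (v i)) (g (v j)) = ~~ ((i.+1 == j) || [&& i == 0, j == 6 & k == 7]).
    rewrite gE /= /compl_edge /= adjE; try lia.
    by rewrite vneq; lia.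
  have gne : g (v i) != g (v j) by rewrite (inj_eq g_inj) vneq; lia.
  have := @cN (g (v i)) (g (v j)); have := @cK (g (v i)) (g (v j)).
  have := @cD (g (v i)) (g (v j)); rewrite E -/(col i) -/(col j) gne.
  case: ifP => /= _; case: (col i) => [[]|]; case: (col j) => [[]|] //=.
  all: move=> cD' cK' cN'.
  all: try by have := cK' _ erefl erefl isT.
  all: try by have := cD' _ erefl erefl.
  all: by have := cN' erefl erefl.
Qed.

(** * The graph construction *)

(** The isomorphism between the two sides and its inverse glue to one involution of all vertices,
    which keeps the subtypes of [induced] out of the later arguments. *)
Lemma comp_sub_pm_involution (G : sgraph) : comp_sub_pm G <->
  exists (A : {set G}) (h : G -> G),
    [/\ involutive h, forall x, (h x \in A) = (x \notin A),
        forall x y, x != y -> (x \in A) = (y \in A) ->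
          edge (h x) (h y) = ~~ edge x y
      & cut_perfect_matching A].
Proof.
split=> [[A [[f [[g fK gK] fE]] pm]]|[A [h [hK hA hE pm]]]].
(* One of the two [insub] succeeds, since the sides cover all vertices. *)
- pose h x := if (insub x : option {x | x \in A}) is Some u then val (f u) else
              if (insub x : option {x | x \in ~: A}) is Some u then val (g u) else x.
  have hT x (xA : x \in A) : h x = val (f (exist _ x xA)) by rewrite /h insubT.
  have hF x (xA : x \in ~: A) : h x = val (g (exist _ x xA)).
    by rewrite /h insubN -?in_setC // insubT.
  have hA x : (h x \in A) = (x \notin A).
    have [xA|xA] := boolP (x \in A).
      by rewrite hT; have := valP (f (exist _ x xA)); rewrite inE => /negbTE.
    rewrite -in_setC in xA; rewrite hF; exact: (valP (g (exist _ x xA))).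
  have hK : involutive h.
    move=> x; have [xA|xA] := boolP (x \in A).
      rewrite (hT x xA) hF => [|hxA]; first exact: (valP (f _)).
      rewrite (_ : exist (fun y => y \in ~: A) _ hxA = f (exist _ x xA)) ?fK //; exact: val_inj.
    rewrite -in_setC in xA; rewrite (hF x xA) hT => [|hxA]; first exact: (valP (g _)).
    rewrite (_ : exist (fun y => y \in A) _ hxA = g (exist _ x xA)) ?gK //; exact: val_inj.
  have hE x y : x != y -> x \in A -> y \in A -> edge (h x) (h y) = ~~ edge x y.
    move=> xy xA yA; rewrite (hT x xA) (hT y yA).
    pose X : induced A := exist _ x xA; pose Y : induced A := exist _ y yA.
    have : @compl_edge (induced (~: A)) (f X) (f Y) = edge x y := fE X Y.
    rewrite /compl_edge (can_eq fK) -val_eqE /= xy /= => <-.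
    by rewrite negbK.
  exists A, h; split=> // x y xy xAyA; have [xA|xA] := boolP (x \in A).
    by apply: hE; rewrite // -xAyA.
  (* Outside [A] the claim is the one for the images, which lie in [A]. *)
  have := @hE (h x) (h y); rewrite !hK !hA -xAyA xA (inv_eq hK) hK.
  by move=> -> //; rewrite negbK.
- exists A; split=> //.
  have hT (x : induced A) : h (val x) \in ~: A by rewrite inE hA (valP x).
  have hF (x : induced (~: A)) : h (val x) \in A by rewrite hA -in_setC (valP x).
  exists (fun x => exist (fun y => y \in ~: A) _ (hT x)); split.
    exists (fun x => exist (fun y => y \in A) _ (hF x)) => x; apply: val_inj => /=; exact: hK.
  move=> x y; change (@compl_edge (induced (~: A))
    (exist (fun y => y \in ~: A) _ (hT x)) (exist (fun y => y \in ~: A) _ (hT y))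
    = edge (val x) (val y)).
  rewrite /compl_edge -val_eqE /= (inv_eq hK) hK /induced_edge /=.
  have [/val_inj ->|xy] := val x =P val y; first by rewrite !edge_irr.
  rewrite hE ?negbK //; first exact/eqP.
  by rewrite (valP x) (valP y).
Qed.

Lemma comp_sub_pm_iso (G H : sgraph) :
  isomorphic G H -> comp_sub_pm G -> comp_sub_pm H.
Proof.
case=> f [[g fK gK] fE] /comp_sub_pm_involution[A [h [hK hA hE pm]]].
have gE x y : edge (g x) (g y) = edge x y by rewrite -fE !gK.
apply/comp_sub_pm_involution; exists (g @^-1: A), (f \o h \o g); split.
- by move=> x /=; rewrite fK hK gK.
- by move=> x; rewrite !inE /= fK hA.
- by move=> x y xy; rewrite !inE /= => ?; rewrite fE hE ?gE // (can_eq gK).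
- move=> x; have [y [[xy yA] uniq_y]] := pm (g x).
  exists (f y); split=> [|z [xz]]; first by rewrite !inE fK -gE fK.
  rewrite !inE -gE in xz * => zA.
  by rewrite -[z]gK; congr f; apply: uniq_y.
Qed.

Lemma isomorphic_sym (G H : sgraph) : isomorphic G H -> isomorphic H G.
Proof.
case=> f [[g fK gK] fE]; exists g; split; first by exists f.
by move=> x y; rewrite -fE !gK.
Qed.

(* The relation between the clique vertex (a, u) and the independent vertex
   (b, v) of the split graph, given [u == v] and the adjacency of u and v. *)
Definition link (a b : nat) (eq adj : bool) : bool :=
  match a, b with
  | 0, 0 | 0, 1 | 1, 0 => eq
  | 1, 1 => adj
  | 1, 2 | 2, 1 => true
  | _, _ => false
  end.

(** Adjacency is a function of kinds, tags and scanned bits, not of vertices, so that the graph and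
    the machine can share it. *)
Definition split_bit (c : bool) (a : nat) (c' : bool) (a' : nat) (eq adj : bool) :=
  if c == c' then c && ~~ ((a == a') && eq) else link a a' eq adj.

Definition same_bit (c : bool) (a : nat) (c' : bool) (a' : nat) (eq : bool) :=
  [&& c == c', a == a' & eq].

Definition glue_bit (s c : bool) (a : nat) (s' c' : bool) (a' : nat)
    (eq adj1 adj2 : bool) :=
  if s == s' then
    if s then split_bit c a c' a' eq adj1
    else ~~ same_bit c a c' a' eq && ~~ split_bit c a c' a' eq adj2
  else same_bit c a c' a' eq.

Lemma linkC a b eq adj : link a b eq adj = link b a eq adj.
Proof. by case: a b => [|[|[|a]]] [|[|[|b]]]. Qed.

Lemma split_bitC c a c' a' eq adj :
  split_bit c a c' a' eq adj = split_bit c' a' c a eq adj.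
Proof.
rewrite /split_bit eq_sym [a == _]eq_sym linkC.
by case: eqP => // ->.
Qed.

Lemma same_bitC c a c' a' eq : same_bit c a c' a' eq = same_bit c' a' c a eq.
Proof. by rewrite /same_bit eq_sym [a == _]eq_sym. Qed.

Lemma glue_bitC s c a s' c' a' eq adj1 adj2 :
  glue_bit s c a s' c' a' eq adj1 adj2 = glue_bit s' c' a' s c a eq adj1 adj2.
Proof.
rewrite /glue_bit eq_sym same_bitC !(split_bitC c).
by case: eqP => // ->.
Qed.

Lemma glue_bit_irr s c a adj1 adj2 : glue_bit s c a s c a true adj1 adj2 = false.
Proof. by rewrite /glue_bit /split_bit /same_bit !eqxx andbF; case: s. Qed.

(** * Split graphs and their gluing *)

Section Glue.
Variable V : finType.

Definition split_vertex := (bool * 'I_3 * V)%type.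
Definition kind (x : split_vertex) : bool := x.1.1.
Definition tag (x : split_vertex) : 'I_3 := x.1.2.

Definition split_edge (e : rel V) : rel split_vertex := fun x y =>
  split_bit (kind x) (tag x) (kind y) (tag y) (x.2 == y.2) (e x.2 y.2).

Definition glue_edge (e1 e2 : rel V) : rel (bool * split_vertex) := fun p q =>
  let x := p.2 in let y := q.2 in
  glue_bit p.1 (kind x) (tag x) q.1 (kind y) (tag y) (x.2 == y.2)
    (e1 x.2 y.2) (e2 x.2 y.2).

Lemma same_bitE (x y : split_vertex) :
  same_bit (kind x) (tag x) (kind y) (tag y) (x.2 == y.2) = (x == y).
Proof. by case: x y => [[c a] u] [[c' a'] v]; rewrite /same_bit andbA. Qed.

Lemma glue_edgeE e1 e2 p q : glue_edge e1 e2 p q =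
  if p.1 == q.1 then
    if p.1 then split_edge e1 p.2 q.2
    else (p.2 != q.2) && ~~ split_edge e2 p.2 q.2
  else p.2 == q.2.
Proof. by rewrite /glue_edge /glue_bit same_bitE. Qed.

Lemma split_edge_kind (e : rel V) x y : kind x = kind y ->
  split_edge e x y = kind x && (x != y).
Proof.
move=> xy; rewrite /split_edge /split_bit -xy eqxx -same_bitE /same_bit -xy eqxx.
by [].
Qed.

Section Sym.
Variables (e1 e2 : rel V).
Hypotheses (e1C : symmetric e1) (e2C : symmetric e2).

Lemma glue_edge_sym : symmetric (glue_edge e1 e2).
Proof.
by move=> p q; rewrite /glue_edge glue_bitC eq_sym e1C e2C.
Qed.

Lemma glue_edge_irr : irreflexive (glue_edge e1 e2).
Proof. by move=> p; rewrite /glue_edge eqxx glue_bit_irr. Qed.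

Definition glue : sgraph := SGraph glue_edge_sym glue_edge_irr.

(* The second side is complemented, so its clique is the part of kind [false]. *)
Definition glue_colour (p : glue) : option bool :=
  if p.1 == kind p.2 then Some p.1 else None.

(** Each side contributes an independent part by construction. A matching edge joins copies of one
    split vertex, whereas the two independent parts have opposite kinds. *)
Lemma glue_colour_None p q :
  glue_colour p = None -> glue_colour q = None -> ~~ edge p q.
Proof.
case: p q => [s x] [s' y]; rewrite /glue_colour /=.
case: eqP => // /eqP xs _; case: eqP => // /eqP ys _.
have {}xs : kind x = ~~ s by case: s (kind x) xs => [] [].
have {}ys : kind y = ~~ s' by case: s' (kind y) ys => [] [].
rewrite glue_edgeE /=; have [ss|ss] := eqVneq s s'.
  by rewrite !split_edge_kind ?xs ?ys ?ss //; case: s' {ss xs ys} => //=; case: eqP.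
by apply: contra ss => /eqP xy; rewrite -[s]negbK -[s']negbK -xs -ys xy.
Qed.

Lemma glue_colour_clique p q b :
  glue_colour p = Some b -> glue_colour q = Some b -> p != q -> edge p q.
Proof.
case: p q => [s x] [s' y]; rewrite /glue_colour /=.
case: eqP => // xs [<-]; case: eqP => // ys [ss]; rewrite {s'}ss in ys *.
move=> xy; have {}xy : x != y by apply: contraNneq xy => ->.
rewrite glue_edgeE /= eqxx !split_edge_kind -?xs -?ys // xy.
by case: s {xs ys}.
Qed.

Lemma glue_colour_disjoint p q b :
  glue_colour p = Some b -> glue_colour q = Some (~~ b) -> ~~ edge p q.
Proof.
case: p q => [s x] [s' y]; rewrite /glue_colour /=.
case: eqP => // xs [<-]; case: eqP => // ys [ss]; rewrite glue_edgeE /= ss.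
have -> : (s == ~~ s) = false by case: (s).
by apply/eqP => xy; move: ss; rewrite ys xs xy; case: (kind y).
Qed.

(** The cut separates the two sides. The map lifts to an isomorphism of the split graphs, and the
    second side is already complemented. *)
Lemma glue_comp_sub_pm (f : V -> V) : bijective f ->
  (forall x y, e2 (f x) (f y) = e1 x y) -> comp_sub_pm glue.
Proof.
case=> g fK gK fE; apply/comp_sub_pm_involution.
pose lft (k : V -> V) (x : split_vertex) : split_vertex := (x.1, k x.2).
pose h (p : glue) : glue := (~~ p.1, lft (if p.1 then f else g) p.2).
have sE x y : split_edge e2 (lft f x) (lft f y) = split_edge e1 x y.
  by rewrite /split_edge /= fE (can_eq fK).
have lK : cancel (lft f) (lft g) by move=> [x u]; rewrite /lft /= fK.
have lK' : cancel (lft g) (lft f) by move=> [x u]; rewrite /lft /= gK.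
exists [set p : glue | p.1], h; split.
- by move=> [[] x]; rewrite /h /= ?lK ?lK'.
- by move=> p; rewrite !inE.
- move=> [s x] [s' y] xy; rewrite !inE /= => ss'; rewrite -{s'}ss' in xy *.
  have {}xy : x != y by apply: contraNneq xy => ->.
  rewrite /edge /= !glue_edgeE /= !eqxx; case: s => /=.
    by rewrite (can_eq lK) xy sE.
  by rewrite xy /= negbK -sE !lK'.
- move=> [s x]; exists (~~ s, x); split.
    by rewrite /edge /= glue_edgeE !inE /= eqxx; case: s.
  move=> [s' y]; rewrite /edge /= glue_edgeE !inE /=.
  by case=> xy; case: s s' xy => [] [] //= /eqP ->.
Qed.

(** * Rigidity of the decompositions *)

Section Forced.
Hypotheses (e1I : irreflexive e1) (e2I : irreflexive e2) (V2 : 1 < #|V|).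

(** Every vertex has two neighbours and two non-neighbours of the opposite kind: the pattern of
    [link] is chosen for this. A second element [v] of [V] supplies witnesses, and irreflexivity
    makes the tag 1 copies of [u] non-adjacent. *)
Lemma split_witnesses (e : rel V) (x : split_vertex) (b : bool) : irreflexive e ->
  exists y z, [/\ y != z, kind y = ~~ kind x, kind z = ~~ kind x,
    split_edge e x y = b & split_edge e x z = b].
Proof.
move=> eI; case: x => [[c a] u].
have [v uv] : exists v, v != u.
  have : 0 < #|[set~ u]| by rewrite cardsC1; lia.
  by case/card_gt0P => v; rewrite !inE; exists v.
pose t i (w : V) : split_vertex := (~~ c, inord i, w).
have tE i w : i < 3 -> split_edge e (c, a, u) (t i w) = link a i (u == w) (e u w).
  move=> i3; rewrite /split_edge /split_bit /tag /kind /= inordK //.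
  by case: c {t}.
have tI i j w w' : i < 3 -> j < 3 -> (t i w == t j w') = (i == j) && (w == w').
  move=> i3 j3; rewrite /t !xpair_eqE eqxx /=; congr (_ && _).
  by rewrite -val_eqE /= !inordK.
have R i w j w' : i < 3 -> j < 3 -> (i != j) || (w != w') ->
   link a i (u == w) (e u w) = b -> link a j (u == w') (e u w') = b ->
   exists y z, [/\ y != z, kind y = ~~ c, kind z = ~~ c,
    split_edge e (c, a, u) y = b & split_edge e (c, a, u) z = b].
  move=> i3 j3 ne Ei Ej; exists (t i w), (t j w').
  by rewrite !tE // tI // negb_and.
have uv' : (u == v) = false by rewrite eq_sym (negbTE uv).
have vu : (v == u) = false by rewrite (negbTE uv).
case: a b R {tE} => [[|[|[|a]]] // a3] [] R /=.
(* Witnesses for the tags 0, 1, 2 in turn, each time neighbours first and then non-neighbours. *)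
- by apply: (R 0 u 1 u); rewrite //= eqxx.
- by apply: (R 2 u 2 v); rewrite //= uv'.
- by apply: (R 2 u 2 v); rewrite //= uv'.
- by apply: (R 1 u 0 v); rewrite //= ?eI ?uv'.
- by apply: (R 1 u 1 v); rewrite //= uv'.
- by apply: (R 2 u 2 v); rewrite //= uv'.
Qed.

Lemma third_of_kind (x y : split_vertex) :
  exists2 z, kind z = kind x & (z != x) && (z != y).
Proof.
case: x y => [[c a] u] [[c' b] v].
have : 0 < #|~: [set a; b]|.
  by rewrite -(leq_add2l #|[set a; b]|) cardsC card_ord cards2; case: (a != b).
case/card_gt0P => d; rewrite !inE negb_or => /andP[da db].
by exists (c, d, u) => //; rewrite !xpair_eqE (negbTE da) (negbTE db) !andbF.
Qed.

(* A vertex of the clique cannot become independent, because its two distinct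
   non-neighbours would be adjacent preimages of independent vertices. *)
Lemma split_iso_kind (d1 d2 : rel V) (phi psi : split_vertex -> split_vertex) :
  irreflexive d2 -> cancel phi psi -> cancel psi phi ->
  (forall x y, split_edge d2 (phi x) (phi y) = split_edge d1 x y) ->
  forall x, kind x -> kind (phi x).
Proof.
move=> d2I phiK psiK phiE x xK; apply: contraT => phixK.
have [y [z [yz yK zK xy xz]]] := split_witnesses (phi x) false d2I.
rewrite (negbTE phixK) in yK zK.
have preI w : kind w -> split_edge d2 (phi x) w = false -> ~~ kind (psi w).
  move=> wK xw; apply/negP => psiwK; move: xw.
  rewrite -[w]psiK phiE split_edge_kind ?xK ?psiwK //=.
  by move/negbFE/eqP => xE; rewrite xE psiK wK in phixK.
have := phiE (psi y) (psi z).
rewrite !psiK split_edge_kind ?yK ?zK // yz => /esym/=.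
by rewrite split_edge_kind (negbTE (preI y _ _)) ?(negbTE (preI z _ _)).
Qed.

Definition cross_degree (e : rel V) x :=
  #|[set y | (kind y != kind x) && split_edge e x y]|.

(** Tag 1 is linked to all #|V| vertices of tag 2 and to one of tag 0. Tag 2 is linked only to the
    #|V| vertices of tag 1, and tag 0 to at most two vertices, where 2 <= #|V|. *)
Lemma cross_degree_tag (e : rel V) x :
  (#|V| < cross_degree e x) = (tag x == 1 :> nat).
Proof.
case: x => [[c a] u]; rewrite /cross_degree /tag /=.
pose t i (w : V) : split_vertex := (~~ c, inord i, w).
have tI i : injective (t i) by move=> w w' [].
have inE' y : y \in [set y | (kind y != c) && split_edge e (c, a, u) y] =
   (kind y == ~~ c) && link a (tag y) (u == y.2) (e u y.2).
  rewrite inE /split_edge /split_bit [kind (_, _, _)]/=.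
  by case: (kind y); case: c {t tI}; rewrite /= ?andbF.
have tP y i : kind y = ~~ c -> val (tag y) = i -> y = t i y.2.
  case: y => [[c' b] v]; rewrite /kind /tag /t /= => -> <-.
  by rewrite inord_val.
case: a inE' => [[|[|[|a]]] // a3] inE' /=.
- apply/negbTE; rewrite -leqNgt; apply: leq_trans V2.
  apply: (@leq_trans #|[set t 0 u; t 1 u]|); last by rewrite cards2; case: eqP.
  apply/subset_leq_card/subsetP => y; rewrite inE' => /andP[/eqP yK].
  rewrite !inE; case E: (val (tag y)) => [|[|[|]]] //= /eqP ->.
    by rewrite -(tP y 0) // eqxx.
  by rewrite -(tP y 1) // eqxx orbT.
- apply: (@leq_trans #|t 0 u |: [set t 2 w | w : V]|).
    rewrite cardsU1 card_imset //; case: imsetP => // -[w _ [/(congr1 val)]].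
    by rewrite /= !inordK.
  apply/subset_leq_card/subsetP => y; rewrite inE' in_setU1 => /orP[/eqP ->|/imsetP[w _ ->]].
    by rewrite /kind /tag /= inordK // !eqxx.
  by rewrite /kind /tag /= inordK // !eqxx.
- apply/negbTE; rewrite -leqNgt -(card_imset V (tI 1)).
  apply/subset_leq_card/subsetP => y; rewrite inE' => /andP[/eqP yK].
  case E: (val (tag y)) => [|[|[|]]] //= _.
  by apply/imsetP; exists y.2; rewrite // -tP.
Qed.

Lemma split_iso_tag (d1 d2 : rel V) (phi : split_vertex -> split_vertex) :
  bijective phi -> (forall x, kind (phi x) = kind x) ->
  (forall x y, split_edge d2 (phi x) (phi y) = split_edge d1 x y) ->
  forall x, (tag (phi x) == 1 :> nat) = (tag x == 1 :> nat).
Proof.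
move=> phi_bij phiK phiE x; rewrite -(cross_degree_tag d2) -(cross_degree_tag d1).
congr (_ < _); rewrite /cross_degree -[RHS](card_imset _ (bij_inj phi_bij)).
apply: eq_card => y; apply/idP/imsetP => [|[z]].
  case: phi_bij => psi _ psiK; rewrite -[y]psiK inE phiE !phiK => ?.
  by exists (psi y); rewrite ?inE.
by rewrite !inE => ? ->; rewrite phiE !phiK.
Qed.

(** As kinds and tag 1 are preserved, [phi] induces on the tag 1 vertices one map of [V] for each
    kind. The tag 0 vertices force the two maps to agree, and the links between tags 1 are the
    adjacency of the original graphs. *)
Lemma split_iso (d1 d2 : rel V) (phi : split_vertex -> split_vertex) :
  irreflexive d1 -> irreflexive d2 -> bijective phi ->
  (forall x y, split_edge d2 (phi x) (phi y) = split_edge d1 x y) ->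
  exists f : V -> V, bijective f /\ forall x y, d2 (f x) (f y) = d1 x y.
Proof.
move=> d1I d2I phi_bij phiE; have [psi phiK psiK] := phi_bij.
have phi_kind x : kind (phi x) = kind x.
  apply/idP/idP => [|xK]; last exact: (split_iso_kind d2I phiK psiK phiE).
  rewrite -{2}[x]phiK; apply: (split_iso_kind d1I psiK phiK).
  by move=> y z; rewrite -phiE !psiK.
have phi_tag := split_iso_tag phi_bij phi_kind phiE.
pose t c i (w : V) : split_vertex := (c, inord i, w).
pose s c u := (phi (t c 1 u)).2.
have phi1 c u : phi (t c 1 u) = t c 1 (s c u).
  have := phi_kind (t c 1 u); have := phi_tag (t c 1 u); rewrite /s /tag /kind.
  case: (phi _) => [[c' a] v] /=; rewrite inordK // => /eqP E ->.
  by congr (_, _, _); apply: val_inj; rewrite /= inordK.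
have tE d c i j u v : i < 3 -> j < 3 ->
    split_edge d (t c i u) (t (~~ c) j v) = link i j (u == v) (d u v).
  by move=> i3 j3; rewrite /split_edge /split_bit /tag /kind /= !inordK //; case: c.
have s0 c u : exists2 a, a != 1 & exists2 w, phi (t c 0 u) = t c a w & a < 3 /\
    (link a 1 (w == s (~~ c) u) (d2 w (s (~~ c) u))).
  have := phi_kind (t c 0 u); have := phi_tag (t c 0 u).
  have := phiE (t c 0 u) (t (~~ c) 1 u); rewrite phi1 tE // eqxx /=.
  case: (phi _) => [[c' a] w]; rewrite /tag /kind /= inordK // => E a1 c'E.
  exists (val a); rewrite ?a1 //; exists w; first by rewrite /t inord_val c'E.
  split; first exact: (ltn_ord a).
  by rewrite -(tE d2 c) ?ltn_ord // /t inord_val -{1}c'E.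
(* The images of the two tag 0 copies of [u] have tags 0 or 2 and are linked. This only happens for
   tags 0 and 0 over one element, which the links to tag 1 identify with both [s false u] and
   [s true u]. *)
have s_eq u : s true u = s false u.
  have [a a1 [w wE [a3 aw]]] := s0 true u; have [b b1 [z zE [b3 bz]]] := s0 false u.
  have := phiE (t true 0 u) (t false 0 u); rewrite wE zE !(tE _ true) //= eqxx.
  case: a b a1 b1 a3 b3 aw bz {wE zE} => [|[|[|]]] // [|[|[|]]] //= _ _ _ _.
  by move=> /eqP <- /eqP <- /eqP ->.
exists (s true); split.
  apply: injF_bij => u v suv; suff [] : t true 1 u = t true 1 v by [].
  by apply: (bij_inj phi_bij); rewrite !phi1 suv.
move=> u v; have := phiE (t true 1 u) (t false 1 v).
by rewrite !phi1 !(tE _ true) //= -s_eq.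
Qed.

Lemma comp_sub_pm_glue : comp_sub_pm glue ->
  exists f : V -> V, bijective f /\ forall x y, e2 (f x) (f y) = e1 x y.
Proof.
case/comp_sub_pm_involution => A [h [hK hA hE pm]].
(* With a single cross edge at [p], two neighbours on one side of the cut keep [p] there. *)
have cut1 (p q r : glue) : edge p q -> edge p r -> q != r ->
    (q \in A) = (r \in A) -> (p \in A) = (q \in A).
  move=> pq pr qr qrA; apply: contraNeq qr => pqA.
  have [y [_ uniq_y]] := pm p; rewrite -(uniq_y q) ?(uniq_y r) //.
  by rewrite -qrA.
have pne s x y : x != y -> ((s, x) : glue) != (s, y) by apply: contraNneq => -[->].
have clique s x y : kind x = s -> kind y = s -> (((s, x) : glue) \in A) = ((s, y) \in A).
  have E s' z w : kind z = s' -> kind w = s' -> z != w -> @edge glue (s', z) (s', w).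
    move=> zs ws zw; apply: (@glue_colour_clique _ _ s'); last exact: pne.
      by rewrite /glue_colour /= zs eqxx.
    by rewrite /glue_colour /= ws eqxx.
  (* If [x] and [y] were separated, a third clique vertex would agree with one of them, and the
     other would have two neighbours across the cut. *)
  move=> xs ys; have [->//|xy] := eqVneq x y.
  have [z zs /andP[zx zy]] := third_of_kind x y; rewrite xs in zs.
  have [//|xyA] := eqVneq (((s, x) : glue) \in A) ((s, y) \in A).
  have [zA|zA] := eqVneq (((s, z) : glue) \in A) ((s, y) \in A).
    by rewrite -zA; apply: (cut1 _ (s, z) (s, y)) => //; [apply: E|apply: E|apply: pne];
      rewrite // eq_sym.
  have {}zA : (((s, z) : glue) \in A) = ((s, x) \in A).
    by move: xyA zA; do 3!case: (_ \in A).
  by rewrite -zA; apply/esym/(cut1 _ (s, z) (s, x)) => //;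
    [apply: E|apply: E|apply: pne]; rewrite // eq_sym.
have [u0 _] : exists u, u \in V by apply/card_gt0P; apply: ltnW.
pose rep s : split_vertex := (s, ord0, u0).
pose m s := ((s, rep s) : glue) \in A.
have mE s x : kind x = s -> (((s, x) : glue) \in A) = m s by move=> xs; apply: clique.
have mTF : m true != m false.
  (* If both cliques lay on one side, [h] would send the non-adjacent [p] and [q] to adjacent
     vertices of the other side; but these are outside the cliques, hence non-adjacent. *)
  apply: contraT => /negPn/eqP mm.
  pose p : glue := (true, rep true); pose q : glue := (false, rep false).
  have pq : @edge glue p q = false by [].
  have hpq : edge (h p) (h q) by rewrite hE ?pq.
  have opp r : (h r \in A) != m true -> glue_colour (h r) = None.
    case: (h r) => s x; rewrite /glue_colour /=; case: (s =P kind x) => // xs.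
    by rewrite mE //; case: (s); rewrite ?mm eqxx.
  suff: ~~ edge (h p) (h q) by rewrite hpq.
  by apply: glue_colour_None; apply: opp; rewrite hA -?[q \in A]/(m false) -?mm
    -?[p \in A]/(m true); case: (m true).
have sideE s x : (((s, x) : glue) \in A) = m s.
  have [/mE//|xs] := eqVneq (kind x) s.
  have {}xs : kind x = ~~ s by case: s (kind x) xs => [] [].
  have [y [z [yz ys zs xy xz]]] : exists y z, [/\ y != z, kind y = s, kind z = s,
      @edge glue (s, x) (s, y) & @edge glue (s, x) (s, z)].
    have eI : irreflexive (if s then e1 else e2) by case: s {xs}.
    (* On the complemented side [false], neighbours are non-neighbours in the split graph, so the
       adjacency to ask for is [s] itself. *)
    have [y [z [yz ys zs xy xz]]] := split_witnesses x s eI.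
    rewrite xs negbK in ys zs.
    have nb w : kind w = s -> split_edge (if s then e1 else e2) x w = s ->
        @edge glue (s, x) (s, w).
      move=> ws xw; have xw' : x != w.
        by apply/eqP => /(congr1 kind); rewrite xs ws; case: (s).
      by rewrite /edge /= glue_edgeE /= eqxx xw'; case: (s) xw => /= ->.
    by exists y, z; split=> //; apply: nb.
  by rewrite (cut1 _ _ _ xy xz) ?mE //; apply: pne.
have h1 p : (h p).1 = ~~ p.1.
  have sideE' q : (q \in A) = m q.1 by rewrite [q]surjective_pairing sideE.
  have := hA p; rewrite !sideE'; move: mTF.
  by case: (fst (h p)); case: (fst p) => //=; case: (m _); case: (m _).
pose phi x := (h (true, x)).2; pose psi x := (h (false, x)).2.
have phiP x : h (true, x) = (false, phi x).
  by rewrite /phi; have := h1 (true, x); case: (h _) => ? ? /= ->.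
have psiP x : h (false, x) = (true, psi x).
  by rewrite /psi; have := h1 (false, x); case: (h _) => ? ? /= ->.
have phiK : cancel phi psi by move=> x; have := hK (true, x); rewrite phiP psiP => -[].
have psiK : cancel psi phi by move=> x; have := hK (false, x); rewrite psiP phiP => -[].
apply: (@split_iso e1 e2 phi) => //; first by exists psi.
move=> x y; have [->|xy] := eqVneq x y; first by rewrite !split_edge_kind // !eqxx !andbF.
have := hE (true, x) (true, y); rewrite !sideE !phiP => /(_ (pne _ _ _ xy) erefl).
rewrite /edge /= !glue_edgeE /= (can_eq phiK) xy /=.
(* The complementation in [hE] and that of the second side cancel. *)
by move/(congr1 negb); rewrite !negbK.
Qed.

End Forced.
End Sym.
End Glue.

(** * The reduction on adjacency matrices *)

(** Entries as a total function on numbers: both matrices can be indexed alike before their sizes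
    are known to agree. *)
Definition mx_bit n (A : 'M[bool]_n) (i j : nat) : bool :=
  if insub i is Some i' then if insub j is Some j' then A i' j' else false
  else false.

Lemma mx_bitE n (A : 'M[bool]_n) (i j : 'I_n) : mx_bit A i j = A i j.
Proof. by rewrite /mx_bit !valK. Qed.

Lemma mx_bit_sym (G : mgraph) : symmetric (mx_bit (adjmx G)).
Proof.
move=> i j; rewrite /mx_bit; case: (insub i) => [i'|]; case: (insub j) => [j'|] //.
exact: mgraph_edge_sym.
Qed.

Lemma mx_bit_irr (G : mgraph) : irreflexive (mx_bit (adjmx G)).
Proof. by move=> i; rewrite /mx_bit; case: insub => // ?; apply: mgraph_edge_irr. Qed.

(* The vertex (s, (c, a, i)) has number t * n + i, where t < 12 encodes (s, c, a). *)
Definition tag_bit (t t' : nat) (eq adj1 adj2 : bool) : bool :=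
  glue_bit (t < 6) (t %% 6 < 3) (t %% 3) (t' < 6) (t' %% 6 < 3) (t' %% 3)
    eq adj1 adj2.

Definition red_bit n (a1 a2 : nat -> nat -> bool) (x y : nat) : bool :=
  tag_bit (x %/ n) (y %/ n) (x %% n == y %% n)
    (a1 (x %% n) (y %% n)) (a2 (x %% n) (y %% n)).

Lemma tag_inj (t t' : nat) : t < 12 -> t' < 12 -> (t < 6) = (t' < 6) ->
  (t %% 6 < 3) = (t' %% 6 < 3) -> t %% 3 = t' %% 3 -> t = t'.
Proof. by do 12?[case: t => [|t] //]; do 12?[case: t' => [|t'] //]. Qed.

Section Reduction.
Variable G1 G2 : mgraph.
Let n := nvert G1.
Let a1 := mx_bit (adjmx G1).
Let a2 := mx_bit (adjmx G2).

Definition red_mx : 'M[bool]_(12 * n) := (\matrix_(x, y) red_bit n a1 a2 x y)%R.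

Lemma red_mxP : [forall i, ~~ red_mx i i] && (red_mx^T == red_mx)%R.
Proof.
apply/andP; split.
  by apply/forallP => x; rewrite mxE /red_bit eqxx /tag_bit glue_bit_irr.
apply/eqP/matrixP => x y; rewrite !mxE /red_bit /tag_bit glue_bitC eq_sym.
by rewrite /a1 /a2 (mx_bit_sym G1) (mx_bit_sym G2).
Qed.

Definition red_graph : mgraph := MGraph red_mxP.

Let e1 : rel 'I_n := fun i j => a1 i j.
Let e2 : rel 'I_n := fun i j => a2 i j.

Fact red_e1_sym : symmetric e1. Proof. by move=> i j; apply: mx_bit_sym. Qed.
Fact red_e2_sym : symmetric e2. Proof. by move=> i j; apply: mx_bit_sym. Qed.

Definition red_glue : sgraph := glue red_e1_sym red_e2_sym.

Lemma red_index (x : 'I_(12 * n)) : x %% n < n.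
Proof. by rewrite ltn_mod; case: (n) x => // -[]. Qed.

Definition red_decode (x : red_graph) : red_glue :=
  let t := x %/ n in (t < 6, (t %% 6 < 3, inord (t %% 3), Ordinal (red_index x))).

(** Both graphs have 12 [n] vertices, so injectivity of the decoding suffices; both adjacencies are
    values of [glue_bit]. *)
Lemma red_graph_glue : isomorphic red_graph red_glue.
Proof.
exists red_decode; split.
  apply: inj_card_bij; last first.
    by rewrite /= !card_prod !card_bool !card_ord; lia.
  move=> x y [] t6 t3 /(congr1 val); rewrite /= !inordK ?ltn_mod // => tm xy.
  apply: val_inj; rewrite /= (divn_eq x n) (divn_eq y n) xy; congr (_ * _ + _).
  have: x %/ n < 12 by rewrite ltn_divLR // (leq_ltn_trans _ (red_index x)).
  have: y %/ n < 12 by rewrite ltn_divLR // (leq_ltn_trans _ (red_index x)).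
  by move=> y12 x12; apply: tag_inj.
move=> x y; rewrite /edge /= /mgraph_edge mxE /glue_edge /red_decode /kind /tag /=.
by rewrite !inordK ?ltn_mod.
Qed.

Lemma red_graph_no_long : no_long_cycle_or_compl red_graph.
Proof.
have [f [f_bij fE]] := red_graph_glue.
pose c (x : red_graph) := glue_colour (f x).
apply: (no_long_cycle_or_compl_of_colouring (c := c)) => x y; rewrite -fE.
- exact: glue_colour_None.
- by move=> b xb yb xy; apply: (glue_colour_clique xb yb); rewrite (bij_eq f_bij).
- exact: glue_colour_disjoint.
Qed.

End Reduction.

Lemma isomorphic_comp_sub_pm_red (G1 G2 : mgraph) : nvert G1 = nvert G2 ->
  isomorphic G1 G2 <-> comp_sub_pm (red_graph G1 G2).
Proof.
move=> eqn; have glueP := red_graph_glue G1 G2.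
have castE (i : 'I_(nvert G1)) : (cast_ord eqn i) = i :> nat by [].
have a1E (i j : 'I_(nvert G1)) : mx_bit (adjmx G1) i j = @edge G1 i j by rewrite mx_bitE.
have a2E (i j : 'I_(nvert G1)) :
    mx_bit (adjmx G2) i j = @edge G2 (cast_ord eqn i) (cast_ord eqn j).
  by rewrite -[in LHS]castE -[X in mx_bit _ _ X]castE mx_bitE.
have cast_bij : bijective (cast_ord eqn).
  by exists (cast_ord (esym eqn)); [apply: cast_ordK|apply: cast_ordKV].
split=> [[f [f_bij fE]]|].
  apply: (comp_sub_pm_iso (isomorphic_sym glueP)).
  pose g i := cast_ord (esym eqn) (f i).
  apply: (@glue_comp_sub_pm _ _ _ _ _ g).
    apply: bij_comp f_bij; exists (cast_ord eqn); [apply: cast_ordKV|apply: cast_ordK].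
  by move=> i j; rewrite /g a1E a2E !cast_ordKV fE.
move=> /(comp_sub_pm_iso glueP) csp.
suff [f [f_bij fE]] : exists f : 'I_(nvert G1) -> 'I_(nvert G1), bijective f /\
    forall i j, mx_bit (adjmx G2) (f i) (f j) = mx_bit (adjmx G1) i j.
  exists (cast_ord eqn \o f); split; first exact: bij_comp.
  by move=> i j; rewrite -a1E -fE a2E.
have [n2|n2] := ltnP 1 (nvert G1).
  apply: (comp_sub_pm_glue _ _ _ csp); rewrite ?card_ord //; move=> i; exact: mx_bit_irr.
(* With at most one vertex there are no edges, and the identity is an isomorphism. *)
exists id; split=> [|i j]; first by exists id.
have lt1 (k : 'I_(nvert G1)) : k = 0 :> nat.
  by apply/eqP; rewrite -leqn0 -ltnS (leq_trans (ltn_ord k)).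
have -> : i = j by apply: ord_inj; rewrite !lt1.
by rewrite (mx_bit_irr G1) (mx_bit_irr G2).
Qed.

Lemma single_mxP : [forall i, ~~ (0 : 'M[bool]_1)%R i i] && ((0 : 'M[bool]_1)^T == 0)%R.
Proof.
apply/andP; split; first by apply/forallP => i; rewrite mxE.
by rewrite trmx0.
Qed.

(** The fixed negative instance returned when the numbers of vertices differ: an isolated vertex has
    no matching edge. *)
Definition single_graph : mgraph := MGraph single_mxP.

Lemma single_graph_no_long : no_long_cycle_or_compl single_graph.
Proof.
apply: (no_long_cycle_or_compl_of_colouring (c := fun=> None)) => // x y _ _.
by rewrite /edge /= /mgraph_edge mxE.
Qed.

Lemma single_graph_comp_sub_pm : ~ comp_sub_pm single_graph.
Proof.
case=> A [_ /(_ ord0)[y [[]]]]; by rewrite /edge /= /mgraph_edge mxE.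
Qed.

Definition red (GH : mgraph * mgraph) : mgraph :=
  if nvert GH.1 == nvert GH.2 then red_graph GH.1 GH.2 else single_graph.

Lemma red_correct GH :
  no_long_cycle_or_compl (red GH) /\ (isomorphic GH.1 GH.2 <-> comp_sub_pm (red GH)).
Proof.
rewrite /red; case: eqP => [eqn|neqn]; split.
- exact: red_graph_no_long.
- exact: isomorphic_comp_sub_pm_red.
- exact: single_graph_no_long.
- split=> [[f [/bij_eq_card]]|/single_graph_comp_sub_pm//].
  by rewrite !card_ord.
Qed.

Lemma enum_ord_pairs n (F : nat -> nat -> bool) (A : 'M[bool]_n) :
  (forall i j : 'I_n, A i j = F i j) ->
  [seq A i j | i <- enum 'I_n, j <- enum 'I_n] = [seq F i j | i <- iota 0 n, j <- iota 0 n].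
Proof.
move=> AF; rewrite -val_enum_ord allpairs_mapl allpairs_mapr.
exact: eq_allpairs.
Qed.

Lemma enc_single : enc_mgraph single_graph = [:: true; false; false].
Proof.
by rewrite /enc_mgraph (@enum_ord_pairs _ (fun _ _ => false)) // => i j; rewrite mxE.
Qed.

Lemma enc_red_graph (G1 G2 : mgraph) (n := nvert G1) :
  enc_mgraph (red_graph G1 G2) = nseq (12 * n) true ++ false ::
  [seq red_bit n (mx_bit (adjmx G1)) (mx_bit (adjmx G2)) x y
     | x <- iota 0 (12 * n), y <- iota 0 (12 * n)].
Proof.
by congr (_ ++ _ :: _); apply: enum_ord_pairs => i j; rewrite mxE.
Qed.

(** * Machine fragments *)

Section Commands.
Variable T : finType.

Definition store := T -> tape.
Definition action := T -> symbol * move.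

(* [cnext] yields [None] when it leaves the fragment, so that the last step of a
   fragment enters its successor. *)
Record cmd := Cmd {
  cstates : finType;
  centry : cstates;
  cnext : cstates -> (T -> symbol) -> option cstates * action
}.

Definition heads (s : store) : T -> symbol := fun x => s x 0%R.
Definition act (a : action) (s : store) : store := fun x => write_move (a x) (s x).
Definition stay (h : T -> symbol) : action := fun x => (h x, MoveN).

Lemma write_move_same (t : tape) m : write_move (t 0%R, m) t = fun i => t (i + offset m)%R.
Proof. by apply: functional_extensionality => i; rewrite /write_move /=; case: eqP => // ->. Qed.

Lemma act_stay s : act (stay (heads s)) s = s.
Proof.
apply: functional_extensionality => x; rewrite /act /stay write_move_same.
by apply: functional_extensionality => i; rewrite GRing.addr0.
Qed.

Inductive runs (c : cmd) : cstates c -> store -> nat -> store -> Prop :=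
| runs_exit q s a : cnext q (heads s) = (None, a) -> runs q s 1 (act a s)
| runs_step q q' s a t s' : cnext q (heads s) = (Some q', a) ->
    runs q' (act a s) t s' -> runs q s t.+1 s'.

Definition exec (c : cmd) (s s' : store) (t : nat) : Prop :=
  exists2 t', t' <= t & runs (centry c) s t' s'.

Lemma exec_leq c s s' t t' : exec c s s' t -> t <= t' -> exec c s s' t'.
Proof. by case=> u ut H tt'; exists u => //; apply: leq_trans tt'. Qed.

Definition Do (f : (T -> symbol) -> action) : cmd :=
  @Cmd unit tt (fun _ h => (None, f h)).

Lemma exec_do f s : exec (Do f) s (act (f (heads s)) s) 1.
Proof. by exists 1 => //; apply: runs_exit. Qed.

Definition Skip : cmd := Do stay.

Lemma exec_skip s : exec Skip s s 1.
Proof. by have := exec_do stay s; rewrite act_stay. Qed.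

Definition Seq (c1 c2 : cmd) : cmd :=
  @Cmd (cstates c1 + cstates c2)%type (inl (centry c1)) (fun q h =>
    match q with
    | inl q1 => let: (o, a) := cnext q1 h in
                (Some (if o is Some q' then inl q' else inr (centry c2)), a)
    | inr q2 => let: (o, a) := cnext q2 h in (omap inr o, a)
    end).

Lemma exec_seq c1 c2 s s1 s2 t1 t2 :
  exec c1 s s1 t1 -> exec c2 s1 s2 t2 -> exec (Seq c1 c2) s s2 (t1 + t2).
Proof.
case=> u1 ut1 H1 [u2 ut2 H2]; exists (u1 + u2); first exact: leq_add.
have {}H2 : @runs (Seq c1 c2) (inr (centry c2)) s1 u2 s2.
  elim: H2 => [q r a E|q q' r a t r' E _ IH]; first by apply: runs_exit; rewrite /= E.
  by apply: runs_step IH; rewrite /= E.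
rewrite /=; elim: H1 H2 => [q r a E|q q' r a t r' E _ IH] H2.
  by apply: runs_step H2; rewrite /= E.
by apply: runs_step (IH H2); rewrite /= E.
Qed.

Definition If (b : (T -> symbol) -> bool) (c1 c2 : cmd) : cmd :=
  @Cmd (option (cstates c1 + cstates c2)) None (fun q h =>
    match q with
    | None => (Some (Some (if b h then inl (centry c1) else inr (centry c2))), stay h)
    | Some (inl q1) => let: (o, a) := cnext q1 h in (omap (Some \o inl) o, a)
    | Some (inr q2) => let: (o, a) := cnext q2 h in (omap (Some \o inr) o, a)
    end).

Lemma exec_if b c1 c2 s s' t :
  exec (if b (heads s) then c1 else c2) s s' t -> exec (If b c1 c2) s s' t.+1.
Proof.
case=> u ut H; exists u.+1 => //.
suff H' : @runs (If b c1 c2)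
    (Some (if b (heads s) then inl (centry c1) else inr (centry c2))) s u s'.
  by apply: runs_step; [rewrite /=; reflexivity | rewrite act_stay].
case: (b _) H => H; elim: H => [q r a E|q q' r a v r' E _ IH].
- by apply: runs_exit; rewrite /= E.
- by apply: runs_step IH; rewrite /= E.
- by apply: runs_exit; rewrite /= E.
- by apply: runs_step IH; rewrite /= E.
Qed.

(** The state [None] performs the test. When the body exits with [None], the successor [Some None]
    is this test state again. *)
Definition While (b : (T -> symbol) -> bool) (c : cmd) : cmd :=
  @Cmd (option (cstates c)) None (fun q h =>
    match q with
    | None => (if b h then Some (Some (centry c)) else None, stay h)
    | Some q => let: (o, a) := cnext q h in (Some o, a)
    end).

Lemma exec_while (b : (T -> symbol) -> bool) c (S : nat -> store) n t :
  (forall k, k < n -> b (heads (S k)) /\ exec c (S k) (S k.+1) t) ->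
  b (heads (S n)) = false ->
  exec (While b c) (S 0) (S n) (n * t.+1 + 1).
Proof.
elim: n S => [|n IH] S H bn.
  exists 1 => //; rewrite -[X in runs _ _ _ X]act_stay.
  by apply: runs_exit; rewrite /= bn.
have [|u uE Hu] := IH (S \o succn) _ bn; first by move=> k kn; apply: (H k.+1).
have [//|b0 [u' uE' Hu']] := H 0; exists (u' + u).+1; first by rewrite mulSn; lia.
suff H' : @runs (While b c) (Some (centry c)) (S 0) (u' + u) (S n.+1).
  by apply: runs_step; [rewrite /= b0; reflexivity | rewrite act_stay].
have {}Hu : @runs (While b c) None (S 1) u (S n.+1) by [].
elim: Hu' Hu => [q r a E|q q' r a v r' E _ IH'] Hu.
  by apply: runs_step Hu; rewrite /= E.
by apply: runs_step (IH' Hu); rewrite /= E.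
Qed.

Fixpoint SeqAll (I : Type) (f : I -> cmd) (r : seq I) : cmd :=
  if r is i :: r' then Seq (f i) (SeqAll f r') else Skip.

(** The intermediate stores are indexed by the prefix of the list already executed. *)
Lemma exec_seqall (I : Type) (f : I -> cmd) (r : seq I) (S : seq I -> store) t :
  (forall r1 i, exec (f i) (S r1) (S (rcons r1 i)) t) ->
  forall r1, exec (SeqAll f r) (S r1) (S (r1 ++ r)) (size r * t + 1).
Proof.
move=> H; elim: r => [|i r IH] r1 /=; first by rewrite cats0; apply: exec_skip.
rewrite mulSn -addnA; apply: (exec_seq (H r1 i)).
by rewrite -cat_rcons.
Qed.

End Commands.

(** * Running a fragment on some of the tracks *)

Section Lift.
Variables (T T' : finType) (emb : T' -> T).
Hypothesis iota_inj : injective emb.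

Definition splice (X : Type) (f : T -> X) (g : T' -> X) : T -> X :=
  fun x => if [pick y | emb y == x] is Some y then g y else f x.

Lemma splice_in X (f : T -> X) g y : splice f g (emb y) = g y.
Proof.
by rewrite /splice; case: pickP => [z /eqP/iota_inj ->|/(_ y)] //; rewrite eqxx.
Qed.

Lemma splice_out X (f : T -> X) g x : (forall y, emb y <> x) -> splice f g x = f x.
Proof. by rewrite /splice => H; case: pickP => // y /eqP /H. Qed.

Definition Lift (c : cmd T') : cmd T :=
  @Cmd T (cstates c) (centry c) (fun q h =>
    let: (o, a) := cnext q (h \o emb) in (o, splice (stay h) a)).

Lemma act_splice a s s' :
  act (splice (stay (heads s)) a) (splice s s') = splice s (act a s').
Proof.
apply: functional_extensionality => x; rewrite /act /splice.
case: pickP => // _; exact: (congr1 (fun f => f x) (act_stay s)).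
Qed.

Lemma splice_comp X (f : T -> X) : splice f (f \o emb) = f.
Proof.
by apply: functional_extensionality => x; rewrite /splice; case: pickP => // y /eqP <-.
Qed.

Lemma exec_lift c s s' t : exec c (s \o emb) s' t -> exec (Lift c) s (splice s s') t.
Proof.
(* The initial store is itself a splice into [s]; every step keeps this form, which carries the
   induction. *)
case=> u ut H; exists u => //=; rewrite -{1}(splice_comp s).
have headsE r : heads (splice s r) \o emb = heads r.
  by apply: functional_extensionality => x; rewrite /= /heads splice_in.
have stayE r a : splice (stay (heads (splice s r))) a = splice (stay (heads s)) a.
  by apply: functional_extensionality => x; rewrite /splice /stay /heads; case: pickP.
elim: H => [q r a E|q q' r a v r' E _ IH].
  by rewrite -act_splice -(stayE r); apply: runs_exit; rewrite /= headsE E.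
by apply: runs_step; [rewrite /= headsE E; reflexivity | rewrite stayE act_splice].
Qed.

End Lift.

(** * From machines to fragments and back *)

Section Machines.

Definition cmd_of_machine (M : machine) : cmd (track M) :=
  @Cmd _ (state M) (start M) (fun q h =>
    if halting q then (None, stay h)
    else let: (q', a) := trans q [ffun x => h x] in (Some q', fun x => a x)).

(** The extra step leaves the fragment from the halting state. *)
Lemma exec_machine (M : machine) (c : config M) t :
  halting (cstate (iter t (@step M) c)) ->
  exists2 u, u <= t.+1 & @runs _ (cmd_of_machine M) (cstate c) (ctape c) u
    (ctape (iter t (@step M) c)).
Proof.
elim: t c => [|t IH] c.
  move=> hc; exists 1 => //; rewrite -[X in runs _ _ _ X]act_stay.
  by apply: runs_exit; rewrite /= /= hc.
rewrite iterSr => /IH[u ut H]; move: H; rewrite {1 2}/step.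
case: ifP => hc H; first by exists u; rewrite // leqW.
exists u.+1 => //; apply: (runs_step _ H); rewrite /= hc.
by case: (trans _ _).
Qed.

Variables (T : finType) (i o : T) (c : cmd T).

Definition machine_of_cmd : machine :=
  @Machine (option (cstates c)) T i o (Some (centry c)) (fun q => q == None)
    (fun q h => if q is Some q then
       let: (q', a) := cnext q h in (q', [ffun x => a x])
     else (None, [ffun x => (h x, MoveN)])).

Lemma machine_of_cmd_outputs w v s t :
  exec c (fun x => if x == i then word_tape w else blank_tape) s t ->
  tape_reads (s o) v -> outputs_within machine_of_cmd w v t.
Proof.
case=> u ut H sv.
suff E : iter u (@step machine_of_cmd) (init machine_of_cmd w)
    = @Config machine_of_cmd None s.
  rewrite /outputs_within -(subnK ut) iterD E.
  have -> : iter (t - u) (@step machine_of_cmd) (@Config machine_of_cmd None s)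
    = @Config machine_of_cmd None s by elim: (t - u) => //= k ->.
  by split.
rewrite /init /=; elim: H => [q r a E|q q' r a k r' E _ IH].
  rewrite /= /step /=; have -> : (fun_of_fin [ffun x => r x 0%R]) = heads r.
    by apply: functional_extensionality => x; rewrite ffunE.
  rewrite E /=; congr Config; apply: functional_extensionality => x.
  by rewrite ffunE.
rewrite iterSr -IH; congr iter; rewrite /step /=.
have -> : (fun_of_fin [ffun x => r x 0%R]) = heads r.
  by apply: functional_extensionality => x; rewrite ffunE.
rewrite E /=; congr Config; apply: functional_extensionality => x.
by rewrite ffunE.
Qed.

End Machines.

(** * Tapes carrying words *)

Definition shift (t : tape) (k : int) : tape := fun i => t (i + k)%R.

(** The tape holding [w] with the head on cell [k] of the word; [k] is an integer because a
    rewinding head visits the blank before the word. *)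
Definition tape_at (w : seq bool) (k : int) : tape := shift (word_tape w) k.

Lemma shiftD t k l : shift (shift t k) l = shift t (k + l)%R.
Proof.
apply: functional_extensionality => i.
by rewrite /shift -GRing.addrA [(l + k)%R]GRing.addrC.
Qed.

Lemma shift0 t : shift t 0%R = t.
Proof. by apply: functional_extensionality => i; rewrite /shift GRing.addr0. Qed.

Lemma write_moveE (t : tape) m : write_move (t 0%R, m) t = shift t (offset m).
Proof. exact: write_move_same. Qed.

Lemma shift_tape_at w k l : shift (tape_at w k) l = tape_at w (k + l)%R.
Proof. exact: shiftD. Qed.

Lemma tape_atR w (k : nat) : shift (tape_at w k) 1 = tape_at w k.+1.
Proof. by rewrite shift_tape_at; congr tape_at; lia. Qed.

Lemma tape_atL w (k : nat) : shift (tape_at w k.+1) (-1) = tape_at w k.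
Proof. by rewrite shift_tape_at; congr tape_at; lia. Qed.

Lemma tape_at_head w (k : nat) : tape_at w k 0%R = onth w k.
Proof. by rewrite /tape_at /shift GRing.add0r. Qed.

Lemma tape_at_blank : tape_at [::] 0 = blank_tape.
Proof. by apply: functional_extensionality => -[i|i]; rewrite /tape_at shift0 //= onth0n. Qed.

Lemma onth_rcons (T : Type) (w : seq T) b k :
  onth (rcons w b) k = if k == size w then Some b else onth w k.
Proof.
rewrite -cats1 onth_cat; case: ltngtP => [//|lt|->]; last by rewrite subnn.
rewrite [RHS]onth_default ?onth_default //=; lia.
Qed.

Lemma write_end w b : write_move (Some b, MoveR) (tape_at w (size w)) =
  tape_at (rcons w b) (size w).+1.
Proof.
apply: functional_extensionality => i; rewrite /write_move /tape_at /shift /=.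
case: eqP => [i0|i0].
  have -> : (i + (size w).+1%:Z)%R = size w by lia.
  by rewrite /= onth_rcons eqxx.
have -> : (i + (size w).+1%:Z)%R = (i + 1 + size w)%R by lia.
have : (i + 1 + size w)%R <> size w by lia.
case: (i + 1 + size w)%R => // k kE; rewrite /= onth_rcons.
by case: eqP => // E; case: kE; rewrite E.
Qed.

(** * Rewinding and counting loops *)

Section Tracks.
Variable T : finType.

Definition upd (s : store T) (x : T) (t : tape) : store T :=
  fun y => if y == x then t else s y.

Lemma upd_same s x t : upd s x t x = t.
Proof. by rewrite /upd eqxx. Qed.

Definition Mv (r : seq T) (m : move) : cmd T :=
  Do (fun h y => (h y, if y \in r then m else MoveN)).

Lemma exec_mv r m s :
  exec (Mv r m) s (fun y => if y \in r then shift (s y) (offset m) else s y) 1.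
Proof.
have := exec_do (fun h y => (h y, if y \in r then m else MoveN)) s.
congr exec; apply: functional_extensionality => y; rewrite /act write_moveE.
by case: ifP => // _; rewrite shift0.
Qed.

Lemma exec_mv1 x m s t : exec (Mv [:: x] m) (upd s x t) (upd s x (shift t (offset m))) 1.
Proof.
have := exec_mv [:: x] m (upd s x t); congr exec.
by apply: functional_extensionality => y; rewrite inE /upd; case: eqP.
Qed.

Definition nonblank (x : T) (h : T -> symbol) : bool := h x != None.

(** The first move leaves the blank after the word, where the head may stand, so that the loop stops
    only at the blank before the word. *)
Definition Rewind (x : T) : cmd T :=
  Seq (Mv [:: x] MoveL) (Seq (While (nonblank x) (Mv [:: x] MoveL)) (Mv [:: x] MoveR)).

Lemma exec_rewind x s w (k : nat) : k <= size w ->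
  exec (Rewind x) (upd s x (tape_at w k)) (upd s x (tape_at w 0)) (k.*2 + 3).
Proof.
move=> kw; pose S j := upd s x (tape_at w (k%:Z - 1 - j%:Z)).
have H1 : exec (While (nonblank x) (Mv [:: x] MoveL)) (S 0) (S k) (k * 2 + 1).
  apply: exec_while => [j jk|]; last first.
    rewrite /nonblank /heads /S upd_same /tape_at /shift GRing.add0r.
    by rewrite (_ : (k%:Z - 1 - k%:Z)%R = Negz 0) //; lia.
  split.
    rewrite /nonblank /heads /S upd_same.
    rewrite (_ : (k%:Z - 1 - j%:Z)%R = (k - j.+1)%N) ?tape_at_head; last by lia.
    by have := onthTE w (k - j.+1); case: onth => //= /esym; lia.
  have := exec_mv1 x MoveL s (tape_at w (k%:Z - 1 - j%:Z)); rewrite shift_tape_at.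
  by congr (exec _ _ (upd _ _ (tape_at _ _))); rewrite /=; lia.
apply: (@exec_leq _ _ _ _ (1 + (k * 2 + 1 + 1))); last by rewrite -muln2; lia.
apply: exec_seq (exec_seq H1 _).
  have := exec_mv1 x MoveL s (tape_at w k); rewrite shift_tape_at.
  by congr (exec _ _ (upd _ _ (tape_at _ _))); rewrite /=; lia.
have := exec_mv1 x MoveR s (tape_at w (k%:Z - 1 - k%:Z)); rewrite shift_tape_at.
by congr (exec _ _ (upd _ _ (tape_at _ _))); rewrite /=; lia.
Qed.

Definition For (x : T) (c : cmd T) : cmd T :=
  Seq (While (nonblank x) (Seq c (Mv [:: x] MoveR))) (Rewind x).

(** The word on track [x] serves as a unary counter, rewound for reuse. Since [upd] overrides track
    [x], [S] describes the other tracks only. *)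
Lemma exec_for x c (S : nat -> store T) w t :
  (forall k, k < size w ->
     exec c (upd (S k) x (tape_at w k)) (upd (S k.+1) x (tape_at w k)) t) ->
  exec (For x c) (upd (S 0) x (tape_at w 0)) (upd (S (size w)) x (tape_at w 0))
    (size w * (t + 4) + 4).
Proof.
move=> H; pose S' k := upd (S k) x (tape_at w k).
apply: (@exec_leq _ _ _ _ (size w * (t + 1).+1 + 1 + ((size w).*2 + 3))); last by lia.
apply: (exec_seq (s1 := S' (size w))) (exec_rewind _ _ (leqnn _)).
apply: (exec_while (S := S')) => [k kw|].
  split.
    rewrite /nonblank /heads /S' upd_same tape_at_head.
    by have := onthTE w k; case: onth => //=; rewrite kw.
  apply: (exec_seq (H k kw)).
  by have := exec_mv1 x MoveR (S k.+1) (tape_at w k); rewrite tape_atR.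
by rewrite /nonblank /heads /S' upd_same tape_at_head onth_default.
Qed.

End Tracks.

(** * The machine computing the reduction *)

(* The input, two unary counters, two copies of the input, the identity matrix,
   and the output. *)
Inductive tr := tIn | tU | tV | tA | tB | tD | tO.

Definition tr_code (x : tr) : 'I_7 :=
  inord match x with tIn => 0 | tU => 1 | tV => 2 | tA => 3 | tB => 4 | tD => 5 | tO => 6 end.

Definition tr_decode (i : 'I_7) : tr :=
  match val i with 0 => tIn | 1 => tU | 2 => tV | 3 => tA | 4 => tB | 5 => tD | _ => tO end.

Fact tr_codeK : cancel tr_code tr_decode.
Proof. by case; rewrite /tr_decode /= inordK. Qed.

HB.instance Definition _ := Countable.copy tr (can_type tr_codeK).
HB.instance Definition _ : isFinite tr := CanIsFinite tr_codeK.

Lemma tr_eqE (x y : tr) : (x == y) = match x, y with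
  | tIn, tIn | tU, tU | tV, tV | tA, tA | tB, tB | tD, tD | tO, tO => true | _, _ => false end.
Proof. by apply/eqP/idP => [->|]; [case: y|case: x; case: y]. Qed.

Definition mk (i u v a b d o : tape) : store tr := fun x =>
  match x with tIn => i | tU => u | tV => v | tA => a | tB => b | tD => d | tO => o end.

Lemma mk_eta s : s = mk (s tIn) (s tU) (s tV) (s tA) (s tB) (s tD) (s tO).
Proof. by apply: functional_extensionality => -[]. Qed.

Lemma upd_mk s x t (s' := upd s x t) : 
  upd s x t = mk (s' tIn) (s' tU) (s' tV) (s' tA) (s' tB) (s' tD) (s' tO).
Proof. exact: mk_eta. Qed.

Lemma updU i u v a b d o t : upd (mk i u v a b d o) tU t = mk i t v a b d o.
Proof. by rewrite upd_mk /upd !tr_eqE. Qed.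
Lemma updV i u v a b d o t : upd (mk i u v a b d o) tV t = mk i u t a b d o.
Proof. by rewrite upd_mk /upd !tr_eqE. Qed.
Lemma updA i u v a b d o t : upd (mk i u v a b d o) tA t = mk i u v t b d o.
Proof. by rewrite upd_mk /upd !tr_eqE. Qed.
Lemma updB i u v a b d o t : upd (mk i u v a b d o) tB t = mk i u v a t d o.
Proof. by rewrite upd_mk /upd !tr_eqE. Qed.
Lemma updD i u v a b d o t : upd (mk i u v a b d o) tD t = mk i u v a b t o.
Proof. by rewrite upd_mk /upd !tr_eqE. Qed.
Lemma updO i u v a b d o t : upd (mk i u v a b d o) tO t = mk i u v a b d t.
Proof. by rewrite upd_mk /upd !tr_eqE. Qed.

Lemma exec_do_mk (f : (tr -> symbol) -> action tr) i u v a b d o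
    (g := f (heads (mk i u v a b d o))) :
  exec (Do f) (mk i u v a b d o)
   (mk (write_move (g tIn) i) (write_move (g tU) u) (write_move (g tV) v)
       (write_move (g tA) a) (write_move (g tB) b) (write_move (g tD) d)
       (write_move (g tO) o)) 1.
Proof. by have := exec_do f (mk i u v a b d o); rewrite [act _ _]mk_eta. Qed.

Lemma exec_mv_mk r m i u v a b d o
    (g := fun x t => if x \in r then shift t (offset m) else t) :
  exec (Mv r m) (mk i u v a b d o)
   (mk (g tIn i) (g tU u) (g tV v) (g tA a) (g tB b) (g tD d) (g tO o)) 1.
Proof. by have := exec_mv r m (mk i u v a b d o); rewrite [fun y => _]mk_eta. Qed.

Definition Emit (b : bool) : cmd tr :=
  Do (fun h x => if x is tO then (Some b, MoveR) else (h x, MoveN)).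

Lemma exec_emit b i u v a b' d w : exec (Emit b)
  (mk i u v a b' d (tape_at w (size w)))
  (mk i u v a b' d (tape_at (rcons w b) (size (rcons w b)))) 1.
Proof.
have := exec_do_mk (fun h x => if x is tO then (Some b, MoveR) else (h x, MoveN))
  i u v a b' d (tape_at w (size w)).
by rewrite /= /heads /= !write_moveE !shift0 write_end size_rcons.
Qed.

Lemma iota0S k : iota 0 k.+1 = rcons (iota 0 k) k.
Proof. by rewrite -addn1 iotaD cats1. Qed.

(** * Writing the new adjacency matrix *)

Section Output.
Variables (n : nat) (i : tape) (w idw : seq bool) (pa pb : nat).
Variables (a1 a2 : nat -> nat -> bool).
Hypothesis aP : forall j k, j < n -> k < n -> onth w (pa + (j * n + k)) = Some (a1 j k).
Hypothesis bP : forall j k, j < n -> k < n -> onth w (pb + (j * n + k)) = Some (a2 j k).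
Hypothesis dP : forall j k, j < n -> k < n -> onth idw (j * n + k) = Some (j == k).

Let un := nseq n false.
Let usz : size un = n. Proof. exact: size_nseq. Qed.

(** The three matrices are read in parallel, at the common offset [x] from their starting points. *)
Definition out_store (hu hv : nat) (x : nat) (o : seq bool) : store tr :=
  mk i (tape_at un hu) (tape_at un hv) (tape_at w (pa + x)%N) (tape_at w (pb + x)%N)
     (tape_at idw x) (tape_at o (size o)).

(** Emits the part of one new row that lies in the columns of tag [t'], then moves back by [n] cells
    so that the same old row can be read for the next tag. *)
Definition Cell (t t' : nat) : cmd tr :=
  Seq (For tU (Do (fun h x => match x with
         | tO => (Some (tag_bit t t' (h tD == Some true) (h tA == Some true)
                          (h tB == Some true)), MoveR)
         | tA | tB | tD => (h x, MoveR)
         | _ => (h x, MoveN) end)))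
      (For tU (Mv [:: tA; tB; tD] MoveL)).

Definition row_word t t' j := [seq tag_bit t t' (j == k) (a1 j k) (a2 j k) | k <- iota 0 n].

Lemma exec_forU c (x : nat -> nat) (o : nat -> seq bool) hv t :
  (forall k, k < n -> exec c (out_store k hv (x k) (o k)) (out_store k hv (x k.+1) (o k.+1)) t) ->
  exec (For tU c) (out_store 0 hv (x 0) (o 0)) (out_store 0 hv (x n) (o n)) (n * (t + 4) + 4).
Proof.
move=> H; have := @exec_for _ tU c (fun k => out_store k hv (x k) (o k)) un t.
by rewrite usz /out_store !updU; apply=> k kn; rewrite !updU; apply: H.
Qed.

Lemma exec_forV c (x : nat -> nat) (o : nat -> seq bool) hu t :
  (forall k, k < n -> exec c (out_store hu k (x k) (o k)) (out_store hu k (x k.+1) (o k.+1)) t) ->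
  exec (For tV c) (out_store hu 0 (x 0) (o 0)) (out_store hu 0 (x n) (o n)) (n * (t + 4) + 4).
Proof.
move=> H; have := @exec_for _ tV c (fun k => out_store hu k (x k) (o k)) un t.
by rewrite usz /out_store !updV; apply=> k kn; rewrite !updV; apply: H.
Qed.

Lemma exec_right hu hv x o :
  exec (Mv [:: tA; tB; tD] MoveR) (out_store hu hv x o) (out_store hu hv x.+1 o) 1.
Proof.
have := exec_mv_mk [:: tA; tB; tD] MoveR i (tape_at un hu) (tape_at un hv)
  (tape_at w (pa + x)%N) (tape_at w (pb + x)%N) (tape_at idw x) (tape_at o (size o)).
by rewrite /= !inE !tr_eqE /= !tape_atR -!addnS.
Qed.

Lemma exec_left hu hv x o :
  exec (Mv [:: tA; tB; tD] MoveL) (out_store hu hv x.+1 o) (out_store hu hv x o) 1.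
Proof.
have := exec_mv_mk [:: tA; tB; tD] MoveL i (tape_at un hu) (tape_at un hv)
  (tape_at w (pa + x.+1)%N) (tape_at w (pb + x.+1)%N) (tape_at idw x.+1) (tape_at o (size o)).
by rewrite /out_store /= !inE !tr_eqE /= !addnS !tape_atL.
Qed.

Lemma exec_leftn hv x o :
  exec (For tU (Mv [:: tA; tB; tD] MoveL)) (out_store 0 hv (x + n) o) (out_store 0 hv x o)
    (n * 5 + 4).
Proof.
have := @exec_forU (Mv [:: tA; tB; tD] MoveL) (fun k => x + (n - k)) (fun=> o) hv 1.
rewrite subn0 subnn addn0; apply=> k kn.
by have := exec_left k hv (x + (n - k.+1)) o; rewrite -addnS subnSK.
Qed.

Lemma exec_rightn hv x o :
  exec (For tU (Mv [:: tA; tB; tD] MoveR)) (out_store 0 hv x o) (out_store 0 hv (x + n) o)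
    (n * 5 + 4).
Proof.
have := @exec_forU (Mv [:: tA; tB; tD] MoveR) (fun k => x + k) (fun=> o) hv 1.
by rewrite addn0; apply=> k kn; rewrite addnS; apply: exec_right.
Qed.

Lemma exec_cell t t' j hv o : j < n ->
  exec (Cell t t') (out_store 0 hv (j * n) o) (out_store 0 hv (j * n) (o ++ row_word t t' j))
    (n * 10 + 8).
Proof.
move=> jn; apply: (@exec_leq _ _ _ _ ((n * 5 + 4) + (n * 5 + 4))); last by lia.
apply: exec_seq (exec_leftn _ _ _).
set c := Do _.
have := @exec_forU c (fun k => j * n + k)
  (fun k => o ++ [seq tag_bit t t' (j == k) (a1 j k) (a2 j k) | k <- iota 0 k]) hv 1.
rewrite addn0 cats0; apply=> k kn.
rewrite (iota0S k) map_rcons -rcons_cat addnS; set o' := o ++ _.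
have := exec_do_mk (fun h x => match x with
         | tO => (Some (tag_bit t t' (h tD == Some true) (h tA == Some true)
                          (h tB == Some true)), MoveR)
         | tA | tB | tD => (h x, MoveR)
         | _ => (h x, MoveN) end) i (tape_at un k) (tape_at un hv)
  (tape_at w (pa + (j * n + k))%N) (tape_at w (pb + (j * n + k))%N) (tape_at idw (j * n + k)%N)
  (tape_at o' (size o')).
rewrite -/c /= /heads /= !write_moveE !shift0 !tape_atR write_end !tape_at_head.
by rewrite aP // bP // dP // /out_store size_rcons !addnS !(inj_eq Some_inj) !eqb_id.
Qed.

(** Emits all [n] new rows of tag [t]: after its twelve cells an old row is left for the next one,
    and the final loop returns over all [n * n] cells. *)
Definition Row t : cmd tr :=
  Seq (For tV (Seq (SeqAll (Cell t) (iota 0 12)) (For tU (Mv [:: tA; tB; tD] MoveR))))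
      (For tV (For tU (Mv [:: tA; tB; tD] MoveL))).

Definition block_word t :=
  flatten [seq flatten [seq row_word t t' j | t' <- iota 0 12] | j <- iota 0 n].

Definition row_time := n * ((12 * (n * 10 + 8) + 1 + (n * 5 + 4)) + 4) + 4
   + (n * ((n * 5 + 4) + 4) + 4).

Lemma exec_row t o :
  exec (Row t) (out_store 0 0 0 o) (out_store 0 0 0 (o ++ block_word t)) row_time.
Proof.
apply: (exec_seq (s1 := out_store 0 0 (n * n) (o ++ block_word t))); last first.
  have := @exec_forV (For tU (Mv [:: tA; tB; tD] MoveL)) (fun k => (n - k) * n)
    (fun=> o ++ block_word t) 0 (n * 5 + 4).
  rewrite subn0 subnn mul0n; apply=> k kn.
  have := exec_leftn k ((n - k.+1) * n) (o ++ block_word t).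
  by rewrite addnC -mulSn subnSK.
set c := Seq _ _.
have := @exec_forV c (fun k => k * n)
  (fun k => o ++ flatten [seq flatten [seq row_word t t' j | t' <- iota 0 12] | j <- iota 0 k])
  0 (12 * (n * 10 + 8) + 1 + (n * 5 + 4)).
rewrite mul0n cats0; apply=> k kn.
rewrite (iota0S k) map_rcons flatten_rcons catA; set o' := o ++ _.
rewrite mulSn [n + _]addnC; apply: exec_seq (exec_rightn _ _ _).
have := @exec_seqall _ _ (Cell t) (iota 0 12)
  (fun r => out_store 0 k (k * n) (o' ++ flatten [seq row_word t t' k | t' <- r])) (n * 10 + 8).
move=> /(_ _ [::]); rewrite cats0 cat0s size_iota; apply=> r t'.
rewrite map_rcons flatten_rcons catA; exact: exec_cell.
Qed.

Definition Output : cmd tr :=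
  Seq (SeqAll (fun _ => For tU (Emit true)) (iota 0 12)) (Seq (Emit false)
  (Seq (SeqAll Row (iota 0 12)) (Rewind tO))).

Definition output_word := nseq (12 * n) true ++ false :: flatten [seq block_word t | t <- iota 0 12].

Definition output_time := (12 * (n * 5 + 4) + 1) + (1 + ((12 * row_time + 1)
  + ((12 * n + (1 + 12 * (n * (12 * n)))).*2 + 3))).

Lemma size_flatten_const (X Y : Type) (f : X -> seq Y) r k :
  (forall x, size (f x) = k) -> size (flatten (map f r)) = size r * k.
Proof. by move=> fk; elim: r => //= x r IH; rewrite size_cat fk IH mulSn. Qed.

Lemma size_output_word : size output_word = 12 * n + (1 + 12 * (n * (12 * n))).
Proof.
rewrite size_cat size_nseq -cat1s size_cat (size_flatten_const _ (k := n * (12 * n))) ?size_iota //.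
move=> t; rewrite (size_flatten_const _ (k := 12 * n)) ?size_iota // => j.
by rewrite (size_flatten_const _ (k := n)) ?size_iota // => t'; rewrite size_map size_iota.
Qed.

Lemma exec_output : exists2 s, exec Output (out_store 0 0 0 [::]) s output_time &
  s tO = tape_at output_word 0.
Proof.
exists (upd (out_store 0 0 0 output_word) tO (tape_at output_word 0)); last by rewrite upd_same.
apply: (exec_seq (s1 := out_store 0 0 0 (nseq (12 * n) true))).
  have := @exec_seqall _ _ (fun _ => For tU (Emit true)) (iota 0 12)
   (fun r => out_store 0 0 0 (nseq (size r * n) true)) (n * 5 + 4).
  move=> /(_ _ [::]); rewrite size_iota; apply=> r t.
  have := @exec_forU (Emit true) (fun=> 0) (fun k => nseq (size r * n + k) true) 0 1.
  rewrite addn0 size_rcons mulSn [n + _]addnC; apply=> k kn.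
  have := exec_emit true i (tape_at un k) (tape_at un 0)
    (tape_at w (pa + 0)%N) (tape_at w (pb + 0)%N) (tape_at idw 0) (nseq (size r * n + k) true).
  have rE m : rcons (nseq m true) true = nseq m.+1 true by elim: m => //= m ->.
  by rewrite addnS -rE.
apply: (exec_seq (exec_emit _ _ _ _ _ _ _ _)).
apply: (exec_seq (s1 := out_store 0 0 0 output_word)).
  have := @exec_seqall _ _ Row (iota 0 12)
   (fun r => out_store 0 0 0
     (rcons (nseq (12 * n) true) false ++ flatten [seq block_word t | t <- r])) row_time.
  move=> /(_ _ [::]); rewrite cats0 size_iota /= cat_rcons; apply=> r t.
  rewrite map_rcons flatten_rcons catA; exact: exec_row.
rewrite -size_output_word {1}/out_store.
rewrite -(updO _ _ _ _ _ _ (tape_at output_word (size output_word))).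
exact: exec_rewind.
Qed.

End Output.

(** * Preparing the tracks *)

(** Two copies, because both matrices lie in one word and are scanned simultaneously. Copying also
    isolates the word, as [tape_reads] only describes the cells up to the first blank. *)
Definition Copy : cmd tr :=
  While (nonblank tIn) (Do (fun h x => match x with
    | tIn | tA | tB => (h tIn, MoveR)
    | _ => (h x, MoveN) end)).

Lemma exec_copy t w u v d o : tape_reads t w ->
  exec Copy (mk t u v blank_tape blank_tape d o)
    (mk (shift t (size w)) u v (tape_at w (size w)) (tape_at w (size w)) d o)
    (size w * 2 + 1).
Proof.
move=> tw; pose S k := mk (shift t (Posz k)) u v (tape_at (take k w) k) (tape_at (take k w) k) d o.
have tE k : k <= size w -> shift t (Posz k) 0%R = onth w k.
  by move=> kw; rewrite /shift GRing.add0r tw.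
have -> : mk t u v blank_tape blank_tape d o = S 0.
  by rewrite /S take0 tape_at_blank shift0.
have -> : mk (shift t (size w)) u v (tape_at w (size w)) (tape_at w (size w)) d o = S (size w).
  by rewrite /S take_size.
apply: exec_while => [k kw|]; last first.
  by rewrite /nonblank /heads /= tE // onth_default.
have Ek : onth w k = Some (nth false w k).
  by rewrite onthE (nth_map false).
split; first by rewrite /nonblank /heads /= tE ?Ek // ltnW.
set f := fun h _ => _.
have := exec_do_mk f (shift t (Posz k)) u v (tape_at (take k w) k) (tape_at (take k w) k) d o.
rewrite /f /heads /= !write_moveE !shift0 tE ?Ek 1?ltnW //.
have wE : write_move (Some (nth false w k), MoveR) (tape_at (take k w) k)
    = tape_at (take k.+1 w) k.+1.
  have sk : size (take k w) = k by rewrite size_takel // ltnW.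
  by have := write_end (take k w) (nth false w k); rewrite sk -take_nth.
rewrite !wE /S; congr (exec _ _ (mk _ _ _ _ _ _ _) _).
by rewrite shiftD; congr shift; rewrite /=; lia.
Qed.

Definition Count : cmd tr :=
  While (fun h => h tA == Some true) (Do (fun h x => match x with
    | tU | tV => (Some false, MoveR)
    | tA | tB => (h x, MoveR)
    | _ => (h x, MoveN) end)).

Lemma exec_count i d o n w : (forall k, k < n -> onth w k = Some true) ->
  onth w n = Some false ->
  exec Count (mk i blank_tape blank_tape (tape_at w 0) (tape_at w 0) d o)
    (mk i (tape_at (nseq n false) n) (tape_at (nseq n false) n) (tape_at w n) (tape_at w n) d o)
    (n * 2 + 1).
Proof.
move=> wT wF; pose S k :=
  mk i (tape_at (nseq k false) k) (tape_at (nseq k false) k) (tape_at w k) (tape_at w k) d o.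
have -> : mk i blank_tape blank_tape (tape_at w 0) (tape_at w 0) d o = S 0.
  by rewrite /S tape_at_blank.
apply: (exec_while (S := S)) => [k kn|]; last by rewrite /heads /= tape_at_head wF.
split; first by rewrite /heads /= tape_at_head wT.
set f := fun h _ => _.
have := exec_do_mk f i (tape_at (nseq k false) k) (tape_at (nseq k false) k)
  (tape_at w k) (tape_at w k) d o.
rewrite /f /heads /= !write_moveE !shift0 !tape_atR.
have -> : write_move (Some false, MoveR) (tape_at (nseq k false) k)
    = tape_at (nseq k.+1 false) k.+1; last by [].
have := write_end (nseq k false) false; rewrite size_nseq => ->; congr tape_at.
by elim: k {kn} => //= k ->.
Qed.

(* The word 1 0^n 1 0^n ... begins with the n x n identity matrix, read by rows. *)
Definition MkId : cmd tr :=
  For tV (Seq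
    (Do (fun h x => if x is tD then (Some true, MoveR) else (h x, MoveN)))
    (For tU (Do (fun h x => match x with
       | tD => (Some false, MoveR) | tB => (h x, MoveR) | _ => (h x, MoveN) end)))).

Definition id_word (n k : nat) : seq bool := flatten (nseq k (true :: nseq n false)).

Lemma id_wordS n k : id_word n k.+1 = rcons (id_word n k) true ++ nseq n false.
Proof.
rewrite /id_word -addn1 nseqD flatten_cat /= cats0 cat_rcons.
by rewrite -[X in _ ++ X]cats0.
Qed.

Lemma size_id_word n k : size (id_word n k) = k * n.+1.
Proof.
by elim: k => // k IH; rewrite id_wordS size_cat size_rcons IH size_nseq mulSn; lia.
Qed.

Lemma onth_id_word_mod n k p : p < k * n.+1 -> onth (id_word n k) p = Some (p %% n.+1 == 0).
Proof.
elim: k p => // k IH p pk; rewrite /id_word /= -cat_cons -/(id_word n k) onth_cat /= size_nseq.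
case: ltnP => [pn|np].
  by rewrite modn_small //; case: p pn {pk} => //= p pn; rewrite onth_nseq; case: ltnP => //; lia.
rewrite IH; last by rewrite mulSn in pk; lia.
by rewrite -{2}(subnK np) modnDr.
Qed.

(** The ones stand at the multiples of [n.+1], and [i * n + j] equals [i * n.+1] plus [j - i], whose
    absolute value is below [n]. *)
Lemma onth_id_word n i j : i < n -> j < n -> onth (id_word n n) (i * n + j) = Some (i == j).
Proof.
move=> i_n jn; rewrite onth_id_word_mod; last by nia.
congr Some; case: (leqP i j) => ij.
  have -> : i * n + j = i * n.+1 + (j - i) by nia.
  by rewrite modnMDl modn_small; lia.
have -> : i * n + j = i.-1 * n.+1 + (n.+1 + j - i) by nia.
by rewrite modnMDl modn_small; lia.
Qed.

(** The head on [tB] advances with every zero written, in total by [n * n] cells: this carries it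
    over the first matrix to the code of the second graph. *)
Lemma exec_mkid i a w p n o (un := nseq n false) :
  exec MkId (mk i (tape_at un 0) (tape_at un 0) a (tape_at w p%:Z) blank_tape o)
    (mk i (tape_at un 0) (tape_at un 0) a (tape_at w (p + n * n)%N)
       (tape_at (id_word n n) (n * n.+1)%N) o)
    (n * ((1 + (n * 5 + 4)) + 4) + 4).
Proof.
have usz : size un = n by apply: size_nseq.
pose Sv hv k := mk i (tape_at un 0) (tape_at un hv) a (tape_at w (p + k * n)%N)
   (tape_at (id_word n k) (k * n.+1)%N) o.
have := @exec_for _ tV _ (Sv 0) un (1 + (n * 5 + 4)).
rewrite usz /Sv !updV mul0n addn0 tape_at_blank; apply=> k kn; rewrite !updV.
apply: (exec_seq (exec_do_mk _ _ _ _ _ _ _ _)).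
rewrite /heads /= !write_moveE !shift0.
have -> : write_move (Some true, MoveR) (tape_at (id_word n k) (k * n.+1)%N) =
    tape_at (rcons (id_word n k) true) (k * n.+1).+1.
  by rewrite -(size_id_word n k) write_end.
pose Su hu j := mk i (tape_at un hu) (tape_at un k) a (tape_at w (p + k * n + j)%N)
   (tape_at (rcons (id_word n k) true ++ nseq j false) ((k * n.+1).+1 + j)%N) o.
have := @exec_for _ tU _ (Su 0) un 1.
rewrite usz /Su !updU !addn0 cats0 id_wordS.
have -> : p + k.+1 * n = p + k * n + n by rewrite mulSn; lia.
have -> : k.+1 * n.+1 = (k * n.+1).+1 + n by rewrite mulSn; lia.
apply=> j jn; rewrite !updU.
have := exec_do_mk (fun h x => match x with
       | tD => (Some false, MoveR) | tB => (h x, MoveR) | _ => (h x, MoveN) end)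
   i (tape_at un j) (tape_at un k) a (tape_at w (p + k * n + j)%N)
   (tape_at (rcons (id_word n k) true ++ nseq j false) ((k * n.+1).+1 + j)%N) o.
rewrite /heads /= !write_moveE !shift0 tape_atR !addnS.
set w' := rcons _ _ ++ _.
have sw' : size w' = (k * n.+1).+1 + j by rewrite size_cat size_rcons size_nseq size_id_word.
have := write_end w' false; rewrite sw' addSn => ->.
rewrite /w' rcons_cat (_ : rcons (nseq j false) false = nseq j.+1 false) //.
by elim: (j) => //= ? ->.
Qed.

(** Compares two unary numbers: they agree exactly if the loop ends with [tU] on its blank and [tB]
    on the separator. *)
Definition Check : cmd tr :=
  While (fun h => (h tU != None) && (h tB == Some true)) (Mv [:: tU; tB] MoveR).

Lemma exec_check i v a d o w p n m (un := nseq n false) (r := minn n m) :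
  (forall k, k < m -> onth w (p + k) = Some true) -> onth w (p + m) = Some false ->
  exec Check (mk i (tape_at un 0) v a (tape_at w p%:Z) d o)
    (mk i (tape_at un r) v a (tape_at w (p + r)%N) d o) (n * 2 + 1).
Proof.
move=> wT wF; pose S k := mk i (tape_at un (Posz k)) v a (tape_at w (p + k)%N) d o.
apply: (@exec_leq _ _ _ _ (r * 2 + 1)); last by rewrite /r; lia.
have -> : mk i (tape_at un 0) v a (tape_at w p%:Z) d o = S 0 by rewrite /S addn0.
apply: (exec_while (S := S)) => [k kr|]; last first.
  rewrite /heads /= !tape_at_head onth_nseq /r.
  by case: (ltnP n m) => nm; rewrite ?ltnn // wF andbF.
split.
  move: kr; rewrite /r leq_min => /andP[kn km].
  by rewrite /heads /= !tape_at_head onth_nseq kn wT.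
have := exec_mv_mk [:: tU; tB] MoveR i (tape_at un k) v a (tape_at w (p + k)%N) d o.
by rewrite /= !inE !tr_eqE /= !tape_atR /S addnS.
Qed.

Definition Succ : cmd tr :=
  Seq (Mv [:: tB] MoveR) (Seq (Rewind tU) (Seq (Rewind tD) Output)).

Definition Fail : cmd tr := Seq (SeqAll Emit [:: true; false; false]) (Rewind tO).

Definition Prog : cmd tr :=
  Seq Copy (Seq (Rewind tA) (Seq (Rewind tB) (Seq Count (Seq (Mv [:: tA; tB] MoveR)
  (Seq (Rewind tU) (Seq (Rewind tV) (Seq MkId (Seq Check
  (If (fun h => (h tU == None) && (h tB == Some false)) Succ Fail))))))))).

Lemma exec_fail i u v a b d : exists2 s, exec Fail (mk i u v a b d blank_tape) s 13 &
  s tO = tape_at [:: true; false; false] 0.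
Proof.
exists (upd (mk i u v a b d blank_tape) tO (tape_at [:: true; false; false] 0)).
  apply: (@exec_leq _ _ _ _ (3 * 1 + 1 + (3.*2 + 3))) => //.
  apply: (exec_seq (s1 := upd (mk i u v a b d blank_tape) tO (tape_at [:: true; false; false] 3))).
    have := @exec_seqall _ _ Emit [:: true; false; false]
      (fun r => mk i u v a b d (tape_at r (size r))) 1.
    move=> /(_ _ [::]); rewrite tape_at_blank updO; apply=> r b'; exact: exec_emit.
  exact: exec_rewind.
by rewrite upd_same.
Qed.

Definition prog_time n L :=
  (L * 2 + 1) + ((L.*2 + 3) + ((L.*2 + 3) + ((n * 2 + 1) + (1 + ((n.*2 + 3) + ((n.*2 + 3) +
  ((n * ((1 + (n * 5 + 4)) + 4) + 4) + ((n * 2 + 1) +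
  ((1 + ((n.*2 + 3) + (((n * n.+1).*2 + 3) + output_time n))) + 13).+1)))))))).

(** * Correctness of the program *)

Section Correct.
Variables (n m : nat) (bits1 bits2 : seq bool) (a1 a2 : nat -> nat -> bool).
Hypotheses (sz1 : size bits1 = n * n) (sz2 : size bits2 = m * m).
Hypothesis a1P : forall j k, j < n -> k < n -> onth bits1 (j * n + k) = Some (a1 j k).
Hypothesis a2P : forall j k, j < m -> k < m -> onth bits2 (j * m + k) = Some (a2 j k).
Let w := nseq n true ++ false :: bits1 ++ nseq m true ++ false :: bits2.

Lemma exec_prog t : tape_reads t w ->
  exists2 s, exec Prog (mk t blank_tape blank_tape blank_tape blank_tape blank_tape blank_tape)
    s (prog_time n (size w)) &
  s tO = tape_at (if n == m then output_word n a1 a2 else [:: true; false; false]) 0.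
Proof.
move=> tw; set un := nseq n false.
have usz : size un = n by apply: size_nseq.
(* The code of the second graph starts after [n] ones, a separator and the first matrix. *)
pose p := n.+1 + n * n.
have wn k : k < n -> onth w k = Some true.
  by move=> kn; rewrite /w onth_cat size_nseq kn onth_nseq kn.
have wnF : onth w n = Some false by rewrite /w onth_cat size_nseq ltnn subnn.
have wa k : k < n * n -> onth w (n.+1 + k) = onth bits1 k.
  move=> kn; rewrite /w onth_cat size_nseq ltnNge addSn leqW ?leq_addr //=.
  by rewrite -addnS addKn /= onth_cat sz1 kn.
have wr k : onth w (p + k) = onth (nseq m true ++ false :: bits2) k.
  rewrite /w onth_cat size_nseq (_ : (p + k < n) = false); last by apply/negbTE; rewrite /p; lia.
  rewrite (_ : p + k - n = (n * n + k).+1) /=; last by rewrite /p; lia.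
  by rewrite onth_cat sz1 ltnNge leq_addr /= addKn.
have wm k : k < m -> onth w (p + k) = Some true.
  by move=> km; rewrite wr onth_cat size_nseq km onth_nseq km.
have wmF : onth w (p + m) = Some false by rewrite wr onth_cat size_nseq ltnn subnn.
have wb k : onth w (p + (m.+1 + k)) = onth bits2 k.
  by rewrite wr onth_cat size_nseq ltnNge addSn leqW ?leq_addr //= -addnS addKn.
set i := shift t (size w); set bl := blank_tape; set id := id_word n n.
pose r := minn n m.
suff [s Hs sO] : exists2 s, exec (If (fun h => (h tU == None) && (h tB == Some false)) Succ Fail)
    (mk i (tape_at un r) (tape_at un 0) (tape_at w n.+1) (tape_at w (p + r)%N)
      (tape_at id (n * n.+1)%N) bl) s
    ((1 + ((n.*2 + 3) + (((n * n.+1).*2 + 3) + output_time n))) + 13).+1 &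
    s tO = tape_at (if n == m then output_word n a1 a2 else [:: true; false; false]) 0.
  exists s => //.
  apply: (exec_seq (exec_copy _ _ _ _ tw)).
  rewrite -/i -(updA i bl bl bl).
  apply: (exec_seq (exec_rewind _ _ (leqnn _))); rewrite updA -(updB i bl bl _ bl).
  apply: (exec_seq (exec_rewind _ _ (leqnn _))); rewrite updB.
  apply: (exec_seq (exec_count _ _ _ wn wnF)).
  apply: (exec_seq (exec_mv_mk _ _ _ _ _ _ _ _ _)).
  rewrite /= !inE !tr_eqE /= !tape_atR -/un -(updU i bl).
  apply: (exec_seq (exec_rewind _ _ _)); rewrite ?usz // updU -(updV i _ bl).
  apply: (exec_seq (exec_rewind _ _ _)); rewrite ?usz // updV.
  apply: (exec_seq (exec_mkid _ _ _ _ _ _)).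
  by apply: (exec_seq (exec_check _ _ _ _ _ _ wm wmF)).
have [nm|nm] := eqVneq n m; last first.
  have [s Hs sO] := exec_fail i (tape_at un r) (tape_at un 0) (tape_at w n.+1)
    (tape_at w (p + r)%N) (tape_at id (n * n.+1)%N).
  exists s => //; apply: exec_if; rewrite /heads /= !tape_at_head onth_nseq.
  rewrite ifF; first by apply: exec_leq Hs _; lia.
  rewrite /r; case: (ltngtP n m) nm => // [lt|gt] _; last by rewrite gt.
  by rewrite wm // andbF.
have rn : r = n by rewrite /r nm minnn.
(* Each matrix starts [n.+1] cells after the start of its graph's code; for the second graph this
   uses [m = n]. *)
have out := @exec_output n i w id n.+1 (p + n.+1) a1 a2.
have [||| s Hs sO] := out.
- by move=> j k jn kn; rewrite wa ?a1P //; nia.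
- by move=> j k jn kn; rewrite -addnA nm wb a2P // -nm.
- by move=> j k jn kn; apply: onth_id_word.
exists s => //; apply: exec_if; rewrite /heads /= !tape_at_head onth_nseq rn ltnn.
rewrite {1}nm wmF /=.
apply: (exec_leq (t := 1 + ((n.*2 + 3) + (((n * n.+1).*2 + 3) + output_time n))));
  last by lia.
apply: (exec_seq (exec_mv_mk _ _ _ _ _ _ _ _ _)).
rewrite /= !inE !tr_eqE /= !tape_atR -(updU i bl).
apply: (exec_seq (exec_rewind _ _ _)); rewrite ?usz // updU -(updD i _ _ _ _ bl).
rewrite -(size_id_word n n); apply: (exec_seq (exec_rewind _ _ (leqnn _))); rewrite updD.
by move: Hs; rewrite /out_store !addn0 addnS tape_at_blank.
Qed.

End Correct.

(** * Polynomial time *)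

Lemma map_iotaM (X : Type) (f : nat -> X) m n : map f (iota 0 (m * n)) =
  flatten [seq [seq f (t * n + i) | i <- iota 0 n] | t <- iota 0 m].
Proof.
elim: m => // m IH; rewrite mulSnr iotaD map_cat IH (iota0S m) map_rcons flatten_rcons.
by congr (_ ++ _); rewrite addnC iotaDl -map_comp.
Qed.

Lemma flatten_flatten (X : Type) (sss : seq (seq (seq X))) :
  flatten (flatten sss) = flatten (map flatten sss).
Proof. by elim: sss => //= ss sss IH; rewrite flatten_cat IH. Qed.

(** The nested loops over [t], [j], [t'], [k] run through the entries of row [t * n + j] and column
    [t' * n + k] in their order in the encoding. *)
Lemma output_wordE n a1 a2 : output_word n a1 a2 = nseq (12 * n) true ++ false ::
  [seq red_bit n a1 a2 x y | x <- iota 0 (12 * n), y <- iota 0 (12 * n)].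
Proof.
congr (_ ++ _ :: _); pose F x := [seq red_bit n a1 a2 x y | y <- iota 0 (12 * n)].
rewrite -/F (map_iotaM F 12 n) flatten_flatten -map_comp.
congr flatten; apply: eq_map => t; rewrite /block_word /comp.
congr flatten; apply/eq_in_map => j; rewrite mem_iota add0n => /andP[_ jn].
rewrite /F map_iotaM; congr flatten; apply: eq_map => t'.
apply/eq_in_map => k; rewrite mem_iota add0n => /andP[_ kn]; rewrite /red_bit.
have n0 : 0 < n by apply: leq_ltn_trans jn.
by rewrite !divnMDl // !modnMDl !divn_small // !addn0 !modn_small.
Qed.

Lemma onth_allpairs_iota (X : Type) (F : nat -> nat -> X) s m n i j : i < m -> j < n ->
  onth [seq F x y | x <- iota s m, y <- iota 0 n] (i * n + j) = Some (F (s + i) j).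
Proof.
elim: m s i => // m IH s [|i] im jn /=; rewrite onth_cat size_map size_iota.
  by rewrite jn onth_map onthE (nth_map 0) ?size_iota //= nth_iota // addn0.
rewrite mulSn -addnA ltnNge leq_addr addKn IH // addSnnS.
by [].
Qed.

Lemma onth_adjmx (G : mgraph) (n := nvert G) j k : j < n -> k < n ->
  onth [seq adjmx G x y | x <- enum 'I_n, y <- enum 'I_n] (j * n + k)
    = Some (mx_bit (adjmx G) j k).
Proof.
move=> jn kn; rewrite (@enum_ord_pairs _ (mx_bit (adjmx G))); last first.
  by move=> x y; rewrite mx_bitE.
exact: onth_allpairs_iota.
Qed.

Lemma exec_prog_red (GH : mgraph * mgraph) t (w := enc_mgraph2 GH) : tape_reads t w ->
  exists2 s, exec Prog (mk t blank_tape blank_tape blank_tape blank_tape blank_tape blank_tape)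
    s (prog_time (nvert GH.1) (size w)) & s tO = tape_at (enc_mgraph (red GH)) 0.
Proof.
case: GH @w => G1 G2 /=.
set w := enc_mgraph2 _; move=> tw.
have wE : w = nseq (nvert G1) true ++ false ::
   [seq adjmx G1 i j | i <- enum 'I_(nvert G1), j <- enum 'I_(nvert G1)] ++ enc_mgraph G2.
  by rewrite /w /enc_mgraph2 /enc_mgraph -catA.
rewrite wE in tw *.
have [||||s Hs sO] := @exec_prog (nvert G1) (nvert G2) _ _
  (mx_bit (adjmx G1)) (mx_bit (adjmx G2)) _ _ _ _ t tw.
- by rewrite size_allpairs -cardE card_ord.
- by rewrite size_allpairs -cardE card_ord.
- by move=> j k; apply: onth_adjmx.
- by move=> j k; apply: onth_adjmx.
exists s => //; rewrite sO /red /=; case: eqP => _; last by rewrite enc_single.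
by rewrite output_wordE -enc_red_graph.
Qed.

Lemma horner_nat_leq (p : {poly nat}) a b : a <= b -> (p.[a])%R <= (p.[b])%R.
Proof.
move=> ab; rewrite !horner_coef; elim/big_ind2: _ => // [x y x' y' xy xy'|i _].
  by rewrite natrDE leq_add.
by rewrite !natrME !natrXE leq_mul //; case: (val i) => // e; rewrite leq_exp2r.
Qed.

(** [n] stands for the number of vertices and [L] for the length of the code; vertices are coded in
    unary, whence [n <= L]. *)
Definition polybounded (f : nat -> nat -> nat) : Prop :=
  exists p : {poly nat}, forall n L, n <= L -> f n L <= (p.[L])%R.

Lemma polybounded_const c : polybounded (fun _ _ => c).
Proof. by exists (c%:P)%R => n L _; rewrite hornerC. Qed.

Lemma polybounded_fst : polybounded (fun n _ => n).
Proof. by exists 'X%R => n L; rewrite hornerX. Qed.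

Lemma polybounded_snd : polybounded (fun _ L => L).
Proof. by exists 'X%R => n L; rewrite hornerX. Qed.

Lemma polybounded_add f g : polybounded f -> polybounded g ->
  polybounded (fun n L => f n L + g n L).
Proof.
case=> p fp [q gq]; exists (p + q)%R => n L nL.
by rewrite hornerD natrDE leq_add ?fp ?gq.
Qed.

Lemma polybounded_mul f g : polybounded f -> polybounded g ->
  polybounded (fun n L => f n L * g n L).
Proof.
case=> p fp [q gq]; exists (p * q)%R => n L nL.
by rewrite hornerM natrME leq_mul ?fp ?gq.
Qed.

Lemma polybounded_prog_time : polybounded prog_time.
Proof.
have add1 f : polybounded f -> polybounded (fun n L => (f n L).+1).
  move=> fp; have [q qP] := polybounded_add fp (polybounded_const 1).
  by exists q => n L /qP; rewrite addn1.
have dbl f : polybounded f -> polybounded (fun n L => (f n L).*2).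
  by move=> fp; have [q qP] := polybounded_add fp fp; exists q => n L /qP; rewrite addnn.
rewrite /prog_time /output_time /row_time.
repeat first [ exact: polybounded_const | exact: polybounded_fst | exact: polybounded_snd
  | apply: polybounded_add | apply: polybounded_mul | apply: (add1) | apply: (dbl)].
Qed.

(** The output of the given machine is the input of the appended fragment, so its length must be
    bounded by the running time. *)
Lemma tape_reads_size (M : machine) (w v : seq bool) t :
  tape_reads (ctape (iter t (@step M) (init M w)) (out_track M)) v ->
  size v <= size w + t.*2.
Proof.
set c := iter t _ _.
(* Relative to the head, a cell moves by at most one per step, and a cell just written has
   coordinate at most 1. Two per step keeps the strict bound even for an empty word. *)
have H : forall x i, ctape c x i <> None -> (i < (size w + t.*2)%:Z)%R.
  rewrite /c; elim: t {c} => [|t IH] x i.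
    rewrite /=; case: eqP => // _; case: i => //= k; rewrite addn0 ltz_nat => wk.
    by rewrite ltnNge; apply/negP => /onth_default.
  rewrite iterS; set c := iter t _ _ in IH *; rewrite /step.
  case: ifP => _; first by move=> /IH; lia.
  rewrite /= /write_move; case: eqP => [i0 _|_ /IH].
    by move: i0; case: (_.2) => /=; lia.
  by case: (_.2) => /=; lia.
case: v => // b v /(_ (size v)) /=; rewrite leqnSn => /(_ isT) vE.
have := H (out_track M) (size v); rewrite -/c vE.
have := onthTE (b :: v) (size v); rewrite /= ltnSn.
by case: onth => // a _ /(_ _); rewrite ltz_nat; apply.
Qed.

Theorem theorem1 :
  GI_hard (restrict CompSubPM (fun G : mgraph => no_long_cycle_or_compl G)).
Proof.
move=> P [f [[M [p Mp]] fP]]; exists (fun a => red (f a)); split; last first.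
  move=> a Pa; have [_ yesE] := fP a Pa; have [no_long redE] := red_correct (f a).
  by split; [split|rewrite yesE].
pose T := (track M + tr)%type.
(* [tIn] is identified with the output track of [M], so that [Prog] reads the result in place. *)
pose emb (x : tr) : T := if x is tIn then inl (out_track M) else inr x.
have emb_inj : injective emb by case=> [] [] // [].
have inl_inj : injective (inl : track M -> T) by move=> x y [].
pose c := Seq (Lift (inl : track M -> T) (cmd_of_machine M)) (Lift emb Prog).
have [q qP] := polybounded_prog_time.
exists (machine_of_cmd (inl (in_track M)) (inr tO) c).
(* [p + 1] pays for [M] and its exit step; ['X + (p + p)] bounds the length of the word passed to
   [Prog]. *)
exists (p + 1 + (q \Po ('X + (p + p))))%R => a Pa.
set w := enc a; have [halt reads] := Mp a Pa.
have vsz := tape_reads_size reads.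
set v := enc (f a) in vsz reads; set t := (p.[size w])%R in halt reads vsz *.
set cf := iter t _ _ in halt reads.
pose s0 (x : T) := if x == inl (in_track M) then word_tape w else blank_tape.
have [u ut Hu] := exec_machine halt.
have H1 : exec (cmd_of_machine M) (s0 \o inl) (ctape cf) t.+1.
  by exists u => //; move: Hu; congr runs; apply: functional_extensionality.
have {}H1 := exec_lift inl_inj H1.
set s1 := splice _ _ _ in H1.
have s1E : s1 \o emb = mk (ctape cf (out_track M)) blank_tape blank_tape blank_tape
    blank_tape blank_tape blank_tape.
  apply: functional_extensionality => x; rewrite /s1 /=.
  by case: x; rewrite /= ?splice_in // splice_out.
have [s2] := exec_prog_red reads; rewrite -s1E => /(exec_lift emb_inj) H2 s2O.
apply: (machine_of_cmd_outputs (s := splice emb s1 s2)).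
  apply: (exec_leq (exec_seq H1 H2)).
  rewrite !hornerD hornerC horner_comp !hornerD hornerX -/t.
  rewrite !natrDE addn1 leq_add2l.
  apply: leq_trans (qP _ _ _) _; last first.
    by apply: horner_nat_leq; rewrite addnn.
  by rewrite /enc /= /enc_mgraph2 size_cat /enc_mgraph size_cat size_nseq -!addnA leq_addr.
rewrite -[inr tO]/(emb tO) splice_in // s2O => k _.
by rewrite /tape_at shift0.
Qed.
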